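(* Let $d\ge1$ and let $(\alpha_1,\alpha_2,\alpha_3)$ be an admissible triple of constants (as defined in the context), depending only on $d$. There exist constants $n_0\ge3$ and $t_0>0$ (depending on $d$) such that the following holds for all odd $n\ge n_0$ and $t\ge t_0$. Suppose that $\{\mathbf{Y}(t):t\ge0\}$ is the smoothing process on $\mathbb{T}_n^d=(\mathbb{Z}/n\mathbb{Z})^d$ associated with simple random walk, with (possibly random) starting configuration $Y_{\mathbf{i}}(0)=y_{\mathbf{i}}\in\mathbb{R}$, $\mathbf{i}\in\mathbb{T}_n^d$. Denote the median of the values $\{y_{\mathbf{i}}:\mathbf{i}\in\mathbb{T}_n^d\}$ by $y^*$. Then $$\mathbb{E}\left(\overline{Y}(t)-\overline{Y}(\infty)\right)^2\le\frac{\alpha_2}{t^{\frac d2+1}\wedge n^{d+2}}\;\mathbb{E}\left[\left(n^{-d}\sum_{\mathbf{i}\in\mathbb{T}_n^d}|y_{\mathbf{i}}-y^*|\right)^2\right]\exp\left(-\left(2\gamma^{(1)}_1d^{-1}-\frac{\alpha_3}{n^{d+4}}\right)t\right).$$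
   Context: $a\wedge b=\min(a,b)$ and $\gamma^{(1)}_1=1-\cos(2\pi/n)$. Vertices $\mathbf{i},\mathbf{j}\in\mathbb{T}_n^d$ are neighbors ($\mathbf{i}\sim\mathbf{j}$) if they differ by $\pm1$ (mod $n$) in exactly one coordinate and agree in the others. Smoothing process on $\mathbb{T}_n^d$: each site carries a unit-intensity Poisson process (clock); all clocks are jointly independent and independent of $\mathbf{Y}(0)$. When the clock at $\mathbf{k}$ rings at time $t$, the value at $\mathbf{k}$ becomes $Y_{\mathbf{k}}(t)=\frac{1}{2d}\sum_{\mathbf{j}\sim\mathbf{k}}Y_{\mathbf{j}}(t-)$ and all other values remain unchanged. $\overline{Y}(t)=n^{-d}\sum_{\mathbf{i}\in\mathbb{T}_n^d}Y_{\mathbf{i}}(t)$; the limit $\overline{Y}(\infty)=\lim_{t\to\infty}\overline{Y}(t)$ exists almost surely. Admissible constants: let $\mathbf{Y}^{(\mathbf{0})}$ be the smoothing process with $Y^{(\mathbf{0})}_{\mathbf{j}}(0)=1$ if $\mathbf{j}=\mathbf{0}$ and $0$ otherwise. Let $\mathcal{E}(t)=\frac{1}{4dn^d}\sum_{\mathbf{i}\sim\mathbf{j}}(Y^{(\mathbf{0})}_{\mathbf{i}}(t)-Y^{(\mathbf{0})}_{\mathbf{j}}(t))^2$ (sum over ordered pairs of neighbors) and $\mathcal{V}(t)=n^{-d}\sum_{\mathbf{i}}(Y^{(\mathbf{0})}_{\mathbf{i}}(t)-n^{-d}\sum_{\mathbf{j}}Y^{(\mathbf{0})}_{\mathbf{j}}(t))^2$.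 Positive constants $(\alpha_1,\alpha_2,\alpha_3)$ depending only on $d$ are admissible if there exist $n_1\ge3$, $t_1>0$ (depending on $d$) such that for all odd $n\ge n_1$ and $t\ge t_1$, $$\frac{\alpha_1 n^{-d}}{t^{\frac d2+1}\wedge n^{d+2}}e^{-2\gamma^{(1)}_1d^{-1}t}\le\mathbb{E}\,\mathcal{E}(t)\le\frac{\alpha_2 n^{-d}}{t^{\frac d2+1}\wedge n^{d+2}}e^{-\left(2\gamma^{(1)}_1d^{-1}-\alpha_3n^{-d-4}\right)t},$$ $$\frac{\alpha_1 n^{-d}}{t^{\frac d2}\wedge n^{d}}e^{-\left(2\gamma^{(1)}_1d^{-1}+\alpha_3n^{-d-4}\right)t}\le\mathbb{E}\,\mathcal{V}(t)\le\frac{\alpha_2 n^{-d}}{t^{\frac d2}\wedge n^{d}}e^{-\left(2\gamma^{(1)}_1d^{-1}-\alpha_3n^{-d-4}\right)t}.$$ Admissible triples exist for every $d\ge1$. *)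

(* Defs.v *)
From HB Require Import structures.
From mathcomp Require Import all_boot all_order all_algebra finmap.
From mathcomp Require Import all_classical all_reals all_analysis.

Set Implicit Arguments.
Unset Strict Implicit.
Unset Printing Implicit Defensive.

Import Order.TTheory GRing.Theory Num.Theory.
Import numFieldNormedType.Exports.

Local Open Scope classical_set_scope.
Local Open Scope ring_scope.

(* 'Z_n is the ring of integers mod n only for 1 < n; every statement below
   takes n >= 3. *)
Definition torus (d n : nat) := {ffun 'I_d -> 'Z_n}.

Definition neighbor (d n : nat) (i j : torus d n) : bool :=
  [exists c : 'I_d, ((i c == j c + 1) || (i c == j c - 1)) &&
    [forall c' : 'I_d, (c' != c) ==> (i c' == j c')]].

(* The middle order statistic, i.e. the median when #|I| is odd; here
   #|I| = n ^ d with n odd. *)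
Definition median (R : realType) (I : finType) (y : I -> R) : R :=
  nth 0 (sort <=%R [seq y i | i <- enum I]) (#|I|./2).

Section independence.
Context (R : realType) (dsp : measure_display) (Omega : measurableType dsp).
Variable P : probability Omega R.

Definition independent_systems (I : choiceType)
    (F : I -> set (set Omega)) : Prop :=
  forall (J : {fset I}) (A : I -> set Omega),
    (forall i, i \in J -> F i (A i)) ->
    P (\bigcap_(i in [set` J]) A i) = (\prod_(i <- J) P (A i))%E.

Definition sigma_rvs (I : Type) (D : set I) (dsp' : measure_display)
    (T : measurableType dsp') (X : I -> Omega -> T) : set (set Omega) :=
  <<s \bigcup_(i in D) preimage_set_system setT (X i) measurable >>.

End independence.

Section poisson_clocks.
Context (R : realType) (dsp : measure_display) (Omega : measurableType dsp).
Variable P : probability Omega R.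

Definition counting_path (f : R -> nat) : Prop :=
  [/\ f 0 = 0%N,
      forall s t, 0 <= s -> s <= t -> (f s <= f t)%N
    & forall t, 0 <= t -> \forall s \near t^'+, f s = f t].

(* f jumps at t *)
Definition rings (f : R -> nat) (t : R) : Prop :=
  0 < t /\ forall s, 0 <= s -> s < t -> (f s < f t)%N.

Record unit_poisson_process (N : R -> {RV P >-> nat}) : Prop := {
  poisson_paths : {ae P, forall w, counting_path (fun t => N t w)} ;
  poisson_indep : forall u : nat -> R, 0 <= u 0%N ->
    (forall m, u m <= u m.+1) ->
    independent_systems P (fun m : nat => preimage_set_system setT
      (fun w => N (u m.+1) w - N (u m) w)%N measurable) ;
  poisson_law : forall s t, 0 <= s -> s < t -> forall k : nat,
    P [set w | (N t w - N s w)%N = k] = (poisson_pmf (t - s) k)%:E }.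

End poisson_clocks.

Section smoothing.
Context (R : realType) (dsp : measure_display) (Omega : measurableType dsp).
Variables (P : probability Omega R) (d n : nat).

(* The value at k changes only when the clock at k rings, and then it becomes
   the average of the left limits at the 2d neighbors of k. *)
Definition smoothing_path (f : torus d n -> R -> nat)
    (y : torus d n -> R -> R) : Prop :=
  (forall k s t, 0 <= s -> s <= t ->
    (forall u, s < u -> u <= t -> ~ rings (f k) u) -> y k t = y k s) /\
  (forall k t, rings (f k) t ->
    y k t = (2 * d)%:R^-1 *
      \sum_(j | neighbor j k) lim (y j s @[s --> t^'-])).

(* The sigma-algebras that have to be independent: None stands for the initial
   configuration, Some k for the clock at k. *)
Definition driving_sigma (N : torus d n -> R -> {RV P >-> nat})
    (Y : torus d n -> R -> {RV P >-> R}) (o : option (torus d n)) :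
    set (set Omega) :=
  match o with
  | None => sigma_rvs setT (fun i w => Y i 0 w)
  | Some k => sigma_rvs [set t : R | 0 <= t] (fun t w => N k t w)
  end.

(* Only times t >= 0 are meaningful in N k t and Y i t. *)
Record smoothing_process (N : torus d n -> R -> {RV P >-> nat})
    (Y : torus d n -> R -> {RV P >-> R}) : Prop := {
  smoothing_clocks : forall k, unit_poisson_process (N k) ;
  smoothing_indep : independent_systems P (driving_sigma N Y) ;
  smoothing_paths : {ae P, forall w,
    smoothing_path (fun k t => N k t w) (fun k t => Y k t w)} }.

Definition torus_mean (y : torus d n -> R) : R :=
  (n ^ d)%:R^-1 * \sum_i y i.

(* The sum runs over ordered pairs of neighbors. *)
Definition energy (y : torus d n -> R) : R :=
  (4 * d * n ^ d)%:R^-1 * \sum_i \sum_(j | neighbor i j) (y i - y j) ^+ 2.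

Definition empirical_variance (y : torus d n -> R) : R :=
  (n ^ d)%:R^-1 * \sum_i (y i - torus_mean y) ^+ 2.

Definition mean_at (Y : torus d n -> R -> {RV P >-> R}) (t : R) (w : Omega) : R :=
  torus_mean (fun i => Y i t w).

Definition mean_limit (Y : torus d n -> R -> {RV P >-> R}) (w : Omega) : R :=
  lim (mean_at Y t w @[t --> +oo]).

End smoothing.

Definition gap (R : realType) (n : nat) : R := 1 - cos (2 * pi / n%:R).

(* The process started from the indicator of the origin is unique in law, so
   the bounds are required of every realization of it. *)
Definition admissible (R : realType) (d : nat) (a1 a2 a3 : R) : Prop :=
  [/\ 0 < a1, 0 < a2, 0 < a3 &
  exists (n1 : nat) (t1 : R), [/\ (3 <= n1)%N, 0 < t1 &
  forall (n : nat) (t : R), odd n -> (n1 <= n)%N -> t1 <= t ->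
  forall (dsp : measure_display) (Omega : measurableType dsp)
    (P : probability Omega R) (N : torus d n -> R -> {RV P >-> nat})
    (Y : torus d n -> R -> {RV P >-> R}),
  smoothing_process N Y ->
  (forall j w, Y j 0 w = (j == 0)%:R) ->
  let rate := 2 * gap R n / d%:R in
  let err := a3 / (n ^ (d + 4))%:R in
  let volE := (n ^ d)%:R^-1 /
    Num.min (t `^ (d%:R / 2 + 1)) (n ^ (d + 2))%:R in
  let volV := (n ^ d)%:R^-1 / Num.min (t `^ (d%:R / 2)) (n ^ d)%:R in
  let EE := ('E_P[fun w => energy (fun i => Y i t w)])%E in
  let EV := ('E_P[fun w => empirical_variance (fun i => Y i t w)])%E in
  [/\ ((a1 * volE * expR (- rate * t))%:E <= EE)%E,
      (EE <= (a2 * volE * expR (- (rate - err) * t))%:E)%E,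
      ((a1 * volV * expR (- (rate + err) * t))%:E <= EV)%E
    & (EV <= (a2 * volV * expR (- (rate - err) * t))%:E)%E]]].

(* Main.v *)
Require Import Defs.
From HB Require Import structures.
From mathcomp Require Import all_boot all_order all_algebra finmap.
From mathcomp Require Import ring lra.
From mathcomp Require Import all_classical all_reals all_analysis measurable_realfun.
Import Order.TTheory GRing.Theory Num.Theory.
Import numFieldNormedType.Exports.
Local Open Scope classical_set_scope.
Local Open Scope ring_scope.

(** Write M = n ^ d for the number of sites and b for the initial median.  The mean
of the values is a martingale: a ring at k moves it by D / M, where D is the
local average at k minus the value at k, and these drifts sum to 0 over k.  The
same ring lowers [energy] by D ^ 2 / M.  Hence (mean - c) ^ 2 + energy / M has
zero drift for every constant c ([lyapunov_sum_update1]), and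
E (mean(T) - mean(t)) ^ 2 <= E energy(t) / M whenever t <= T.

The process is linear in its starting configuration and fixes constants, so
mean(T) - mean(t) is the sum over k of (y_k - b) X_k, where X_k is the increment
for the process started from the indicator of k and is independent of y.  By the
Cauchy-Schwarz inequality [sqr_sum_le] its second moment is at most
E (sum_k |y_k - b|) ^ 2 times the maximum of the E X_k ^ 2.  Translation
invariance makes the E X_k ^ 2 equal, and E energy(t) / M for the process
started from the indicator of 0 bounds them; the admissibility hypothesis
controls that energy, which gives exactly the constant claimed.

The argument is carried out on a grid.  During a time interval of length h the
set of clocks that ring contains each site independently with probability
1 - exp(- h), and the grid chain averages simultaneously at all sites of that
set ([chain]).  The sets of different intervals are independent, so expectations
for the grid chain are finite sums ([expect]), and an interval with two or more
rings costs O(h ^ 2).  Along a path with finitely many ring times before T, no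
interval contains two distinct ones when h is small, and then the grid chain
agrees with the process at grid times ([smoothing_grid]); bounds for the grid
chain therefore pass to the limit by the lemma of Fatou ([functional_bound]).
Admissibility speaks of a process started from the indicator of 0, so such a
process is constructed on the given clocks: it solves the dynamics pathwise
([solution]) and is measurable as a limit of grid chains ([delta_process]).

Letting T tend to infinity requires the mean to converge almost surely.  Values
at later times stay in the range of those at an earlier time
([smoothing_max_principle]), and the spread tends to 0 along multiples of t
because the admissible bound on the variance decays exponentially.  That needs
2 gap / d > a3 / n ^ (d + 4), true for large n since gap is at least 2 / n ^ 2
([gap_lower_bound]); it is the reason for enlarging n1. *)

Set Implicit Arguments.
Unset Strict Implicit.
Unset Printing Implicit Defensive.

(** * The torus graph *)

Lemma neighbor_sym (d n : nat) (i j : torus d n) : neighbor i j = neighbor j i.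
Proof.
suff H (a b : torus d n) : neighbor a b -> neighbor b a by apply/idP/idP; exact: H.
case/existsP => c /andP[h1 /forallP h2]; apply/existsP; exists c; apply/andP; split.
  by case/orP: h1 => /eqP ->; rewrite ?addrK ?subrK eqxx ?orbT.
by apply/forallP => c'; apply/implyP => /(implyP (h2 c')) /eqP ->.
Qed.

(** The two neighbors of k along each axis, indexed by a direction and a
    sign. *)
Definition unit_step (d n : nat) (p : 'I_d * bool) (k : torus d n) : torus d n :=
  [ffun c => if c == p.1 then k c + (-1) ^+ p.2 else k c].

Lemma neighborE (d n : nat) (i k : torus d n) :
  neighbor i k = [exists p : 'I_d * bool, i == unit_step p k].
Proof.
apply/existsP/existsP => [[c /andP[h1 /forallP h2]]|[[c b] /eqP ->]].
  have [b hb] : exists b : bool, i c = k c + (-1) ^+ b.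
    by case/orP: h1 => /eqP ->; [exists false|exists true].
  exists (c, b); apply/eqP/ffunP => c'; rewrite ffunE /=.
  by case: eqVneq => [->//|ne]; apply/eqP; exact: (implyP (h2 c')).
exists c; rewrite !ffunE eqxx /=; apply/andP; split.
  by case: b; rewrite eqxx ?orbT.
by apply/forallP => c'; apply/implyP => /negPf ne; rewrite ffunE ne.
Qed.

Lemma Zp_one_neq_opp (n : nat) : (3 <= n)%N -> (1 : 'Z_n) != -1.
Proof.
move=> n3; rewrite -subr_eq0 opprK; apply/eqP => /(congr1 val) /=.
case: n n3 => [|[|[|n]]] //= _.
Qed.

(** The two signs give different neighbors because 1 and -1 differ mod n for n
    at least 3; this is where the degree of the torus graph becomes 2d. *)
Lemma unit_step_inj (d n : nat) (k : torus d n) : (3 <= n)%N ->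
  injective (fun p : 'I_d * bool => unit_step p k).
Proof.
move=> n3 [c b] [c' b'] /ffunP/(_ c); rewrite !ffunE eqxx /=.
case: eqVneq => [<-|_].
  move/addrI; case: b; case: b' => //.
    by rewrite expr1 expr0 => /esym/eqP; rewrite (negPf (Zp_one_neq_opp n3)).
  by rewrite expr1 expr0 => /eqP; rewrite (negPf (Zp_one_neq_opp n3)).
move/eqP; rewrite -subr_eq0 addrC addKr => /eqP h.
have : (-1) ^+ b * (-1) ^+ b = 0 :> 'Z_n by rewrite h mulr0.
by rewrite -expr2 sqrr_sign => /eqP; rewrite oner_eq0.
Qed.

Lemma card_neighbor (d n : nat) (k : torus d n) : (3 <= n)%N ->
  #|[pred j | neighbor j k]| = (2 * d)%N.
Proof.
move=> n3; rewrite -[RHS]mulnC -[in RHS](card_ord d) -card_bool -card_prod.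
rewrite -(fintype.card_image (@unit_step_inj _ _ k n3)); apply: eq_card => j.
rewrite inE neighborE; apply/existsP/fintype.imageP => [[p /eqP ->]|[p _ ->]].
  by exists p.
by exists p.
Qed.

Lemma neighbor_irr (d n : nat) (k : torus d n) : (3 <= n)%N -> neighbor k k = false.
Proof.
move=> n3; rewrite neighborE; apply/existsP => -[[c b] /eqP /ffunP/(_ c)].
rewrite ffunE eqxx /= => /esym/eqP; rewrite -subr_eq0 addrC addKr => /eqP h.
have : (-1) ^+ b * (-1) ^+ b = 0 :> 'Z_n by rewrite h mulr0.
by rewrite -expr2 sqrr_sign => /eqP; rewrite oner_eq0.
Qed.

Lemma card_torus (d n : nat) : (2 <= n)%N -> #|torus d n| = (n ^ d)%N.
Proof. by move=> n2; rewrite card_ffun !card_ord Zp_cast. Qed.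

(** * Local averages, energy and the grid chain *)

Section averaging.
Context {R : realType} {d n : nat}.
Hypothesis d1 : (1 <= d)%N.
Hypothesis n3 : (3 <= n)%N.
Local Notation K := (torus d n).
Implicit Types (x u : K -> R) (k : K) (S : {set K}) (l : seq {set K}).

Definition ave x k : R := (2 * d)%:R^-1 * \sum_(j | neighbor j k) x j.
Definition update S x : K -> R := fun k => if k \in S then ave x k else x k.
(** The grid chain: the sets of sites that ring in successive time intervals
    are applied in turn, all the sites of one set being averaged
    simultaneously. *)
Definition chain l x : K -> R := foldl (fun x S => update S x) x l.

Let d2 : (2 * d)%:R != 0 :> R.
Proof. by rewrite pnatr_eq0; case: d d1. Qed.
Let M0 : (n ^ d)%:R != 0 :> R.
Proof. by rewrite pnatr_eq0 expn_eq0; case: n n3. Qed.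

Lemma sum_neighbor (a : R) k : \sum_(j | neighbor j k) a = (2 * d)%:R * a.
Proof.
rewrite big_const iter_addr_0 mulr_natl; congr (_ *+ _); exact: card_neighbor.
Qed.

Lemma update_lin (I : finType) (z : I -> R) (x : I -> K -> R) S :
  update S (fun k => \sum_i z i * x i k) = (fun k => \sum_i z i * update S (x i) k).
Proof.
apply/funext => k; rewrite /update /ave; case: ifP => // _.
rewrite exchange_big mulr_sumr; apply: eq_bigr => i _.
by rewrite -mulr_sumr mulrCA.
Qed.

Lemma chain_lin (I : finType) (z : I -> R) (x : I -> K -> R) l :
  chain l (fun k => \sum_i z i * x i k) = (fun k => \sum_i z i * chain l (x i) k).
Proof.
elim: l x => [//|S l IH] x; rewrite /chain /= update_lin.
exact: (IH (fun i => update S (x i))).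
Qed.

Lemma ave_cst (a : R) k : ave (fun=> a) k = a.
Proof. by rewrite /ave sum_neighbor mulKf. Qed.

Lemma chain_cst (a : R) l : chain l (fun=> a) = (fun=> a).
Proof.
elim: l => [//|S l IH]; rewrite /chain /= (_ : update S _ = fun=> a) ?IH //.
by apply/funext => k; rewrite /update ave_cst if_same.
Qed.

Lemma ave_ge (a : R) x k : (forall j, a <= x j) -> a <= ave x k.
Proof.
move=> h; rewrite -[leLHS](ave_cst a k) /ave.
by apply: ler_wpM2l; [rewrite invr_ge0|apply: ler_sum => j _; exact: h].
Qed.

Lemma ave_le (b : R) x k : (forall j, x j <= b) -> ave x k <= b.
Proof.
move=> h; rewrite -[leRHS](ave_cst b k) /ave.
by apply: ler_wpM2l; [rewrite invr_ge0|apply: ler_sum => j _; exact: h].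
Qed.

Lemma update_bounds (a b : R) S x : (forall j, a <= x j <= b) ->
  forall j, a <= update S x j <= b.
Proof.
move=> h j; rewrite /update; case: ifP => // _.
by rewrite ave_ge ?ave_le // => i; case/andP: (h i).
Qed.

Lemma chain_bounds (a b : R) l x : (forall j, a <= x j <= b) ->
  forall j, a <= chain l x j <= b.
Proof. by elim: l x => [//|S l IH] x h; apply: IH; exact: update_bounds. Qed.

Lemma chain_cat l1 l2 x : chain (l1 ++ l2) x = chain l2 (chain l1 x).
Proof. by rewrite /chain foldl_cat. Qed.

(** Summation by parts: each unordered pair of neighbors is counted twice, and
    exchanging the roles of i and j turns the second half of the product into
    the first. *)
Lemma green u x : \sum_i \sum_(j | neighbor i j) (u i - u j) * (x i - x j) =
  (4 * d)%:R * \sum_i u i * (x i - ave x i).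
Proof.
under eq_bigr => i _ do (under eq_bigr => j _ do rewrite mulrBl).
under eq_bigr => i _ do rewrite sumrB.
rewrite sumrB.
have -> : \sum_i \sum_(j | neighbor i j) u j * (x i - x j) =
   - \sum_i \sum_(j | neighbor i j) u i * (x i - x j).
  rewrite (exchange_big_dep xpredT) //= -sumrN; apply: eq_bigr => j _; rewrite -sumrN.
  under eq_bigl => i do rewrite neighbor_sym.
  by apply: eq_bigr => i _; rewrite -mulrN opprB.
rewrite opprK -mulr2n -[LHS]mulr_natl (_ : (4 * d)%:R = 2 * (2 * d)%:R :> R); last first.
  by rewrite -natrM mulnA.
rewrite -mulrA; congr (_ * _); rewrite mulr_sumr; apply: eq_bigr => i _.
under eq_bigl => j do rewrite neighbor_sym.
rewrite -mulr_sumr mulrCA; congr (_ * _).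
by rewrite sumrB sum_neighbor /ave mulrBr mulVKf.
Qed.

(** Green formula against the constant 1: the infinitesimal drift of the mean
    vanishes. *)
Lemma sum_drift x : \sum_i (ave x i - x i) = 0.
Proof.
have := green (fun=> 1) x.
rewrite big1 => [|i _]; last by rewrite big1 // => j _; rewrite subrr mul0r.
move/esym/eqP; rewrite mulf_eq0 pnatr_eq0 muln_eq0 /=.
rewrite (_ : (d == 0)%N = false) /=; last by case: d d1.
move=> /eqP h; transitivity (- \sum_i 1 * (x i - ave x i)); last by rewrite h oppr0.
by rewrite -sumrN; apply: eq_bigr => i _; rewrite mul1r opprB.
Qed.

(** Averaging at one site is a rank-one perturbation, so both the mean and the
    energy change by explicit amounts. *)
Lemma update1E k x : update [set k]%SET x = (fun i => x i + (ave x k - x k) * (i == k)%:R).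
Proof.
apply/funext => i; rewrite /update !inE; case: eqVneq => [->|_].
  by rewrite mulr1 addrC subrK.
by rewrite mulr0 addr0.
Qed.

Lemma sum_single (F : K -> R) k : \sum_i F i * (i == k)%:R = F k.
Proof.
rewrite (bigD1 k) //= eqxx mulr1 big1 ?addr0 // => i /negPf ->.
by rewrite mulr0.
Qed.

Lemma torus_mean_update1 k x :
  torus_mean (update [set k]%SET x) = torus_mean x + (n ^ d)%:R^-1 * (ave x k - x k).
Proof.
by rewrite update1E /torus_mean big_split /= mulrDr (sum_single (fun=> _)).
Qed.

Lemma energyE x : energy x = (n ^ d)%:R^-1 * \sum_i x i * (x i - ave x i).
Proof.
rewrite /energy.
under eq_bigr => i _ do (under eq_bigr => j _ do rewrite expr2).
rewrite green mulrA; congr (_ * _).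
rewrite natrM invfM mulrC mulrA divff ?mul1r // natrM mulf_neq0 // pnatr_eq0.
by case: d d1.
Qed.

(** Expanding the square, the cross term is Green formula against the indicator
    of k, and the indicator itself has Dirichlet form 4d because k is not its
    own neighbor. *)
Lemma energy_update1 k x :
  energy (update [set k]%SET x) = energy x - (n ^ d)%:R^-1 * (ave x k - x k) ^+ 2.
Proof.
set D := ave x k - x k; pose b i : R := (i == k)%:R.
have green' u v : \sum_i \sum_(j | neighbor i j) (u i - u j) * (v i - v j) =
  (4 * d)%:R * \sum_i u i * (v i - ave v i) by exact: green.
have E : \sum_i \sum_(j | neighbor i j) (update [set k]%SET x i - update [set k]%SET x j) ^+ 2 =
  \sum_i \sum_(j | neighbor i j) (x i - x j) ^+ 2 +
  (2 * D * \sum_i \sum_(j | neighbor i j) (b i - b j) * (x i - x j) +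
   D ^+ 2 * \sum_i \sum_(j | neighbor i j) (b i - b j) * (b i - b j)).
  rewrite !mulr_sumr -!big_split; apply: eq_bigr => i _ /=.
  rewrite !mulr_sumr -!big_split; apply: eq_bigr => j _ /=.
  by rewrite update1E -/D -/(b i) -/(b j); ring.
have sb v : \sum_i b i * v i = v k.
  by rewrite -[RHS](sum_single v); apply: eq_bigr => i _; rewrite mulrC.
have avb : ave b k = 0.
  rewrite /ave big1 ?mulr0 // => j; rewrite /b; case: eqVneq => // ->.
  by rewrite neighbor_irr.
rewrite /energy E !green' (sb (fun i => x i - ave x i)) (sb (fun i => b i - ave b i)) avb.
rewrite /b eqxx subr0 -[x k - _]opprB -/D mulrDr; congr (_ + _).
have q0 : (4 * d)%:R != 0 :> R by rewrite pnatr_eq0; case: d d1.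
rewrite natrM (_ : true%:R = 1) //; move: q0 M0.
by move: (4 * d)%:R (n ^ d)%:R => q m q0 m0; field; rewrite m0 q0.
Qed.

(** The squared displacement of the mean from c, compensated by the energy that
    remains to be dissipated. *)
Definition lyapunov (c : R) x := (torus_mean x - c) ^+ 2 + (n ^ d)%:R^-1 * energy x.

Lemma lyapunov_update1 c k x : lyapunov c (update [set k]%SET x) =
  lyapunov c x + 2 * (n ^ d)%:R^-1 * (torus_mean x - c) * (ave x k - x k).
Proof. by rewrite /lyapunov torus_mean_update1 energy_update1; ring. Qed.

(** The D ^ 2 terms of the two summands cancel, and the remaining cross terms
    are proportional to the drift of the mean. *)
Lemma lyapunov_sum_update1 c x :
  \sum_k (lyapunov c (update [set k]%SET x) - lyapunov c x) = 0.
Proof.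
under eq_bigr => k _ do rewrite lyapunov_update1 addrC addKr.
by rewrite -mulr_sumr sum_drift mulr0.
Qed.

Lemma torus_mean_bounds (a b : R) x : (forall j, a <= x j <= b) -> a <= torus_mean x <= b.
Proof.
move=> h; have M1 : 0 <= (n ^ d)%:R^-1 :> R by rewrite invr_ge0.
have cst (e : R) : (n ^ d)%:R^-1 * \sum_(i : K) e = e.
  rewrite big_const iter_addr_0 card_torus; last exact: ltnW.
  by rewrite -[X in _ * X]mulr_natl mulKf.
apply/andP; split.
  by rewrite -[leLHS]cst; apply: ler_wpM2l => //; apply: ler_sum => i _; case/andP: (h i).
by rewrite -[leRHS]cst; apply: ler_wpM2l => //; apply: ler_sum => i _; case/andP: (h i).
Qed.

Lemma energy_ge0 x : 0 <= energy x.
Proof.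
rewrite /energy mulr_ge0 // sumr_ge0 // => i _.
by apply: sumr_ge0 => j _; rewrite sqr_ge0.
Qed.

Lemma sqr_sub_le1 (a b : R) : 0 <= a <= 1 -> 0 <= b <= 1 -> (a - b) ^+ 2 <= 1.
Proof. by move=> /andP[a0 a1] /andP[b0 b1]; nra. Qed.

Definition energy_bound : R := (4 * d * n ^ d)%:R^-1 * \sum_(i : K) \sum_(j | neighbor i j) 1.

Lemma energy_le x : (forall j, 0 <= x j <= 1) -> energy x <= energy_bound.
Proof.
move=> h; apply: ler_wpM2l; first by rewrite invr_ge0.
by apply: ler_sum => i _; apply: ler_sum => j _; exact: sqr_sub_le1.
Qed.

(** Crude bound for [lyapunov] on configurations with values in the unit
    interval; only its finiteness matters, since it multiplies a vanishing
    error. *)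
Definition lyapunov_bound : R := 1 + (n ^ d)%:R^-1 * energy_bound.

Lemma lyapunov_ge0 c x : 0 <= lyapunov c x.
Proof. by rewrite addr_ge0 ?sqr_ge0 // mulr_ge0 ?energy_ge0 // invr_ge0. Qed.

Lemma lyapunov_le c x : 0 <= c <= 1 -> (forall j, 0 <= x j <= 1) ->
  lyapunov c x <= lyapunov_bound.
Proof.
move=> hc hx; apply: lerD; first by apply: sqr_sub_le1 => //; exact: torus_mean_bounds.
by apply: ler_wpM2l; [rewrite invr_ge0|exact: energy_le].
Qed.

Lemma torus_mean_lin (z : K -> R) (x : K -> K -> R) :
  torus_mean (fun k => \sum_i z i * x i k) = \sum_i z i * torus_mean (x i).
Proof.
rewrite /torus_mean exchange_big mulr_sumr; apply: eq_bigr => i _.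
by rewrite -mulr_sumr mulrCA.
Qed.

Lemma torus_mean_add_cst (x : K -> R) b : torus_mean (fun k => x k + b) = torus_mean x + b.
Proof.
rewrite /torus_mean big_split /= mulrDr; congr (_ + _).
rewrite big_const iter_addr_0 card_torus; last exact: ltnW.
by rewrite -[X in _ * X]mulr_natl mulKf // pnatr_eq0 expn_eq0; case: n n3.
Qed.

Lemma chain_add_cst l (x : K -> R) b : chain l (fun k => x k + b) = (fun k => chain l x k + b).
Proof.
have := chain_lin (fun i : bool => if i then 1 else b) (fun (i : bool) k => if i then x k else 1) l.
rewrite (_ : (fun k => _) = (fun k => x k + b)); last first.
  by apply/funext => k; rewrite big_bool /= mul1r mulr1.
by move=> ->; apply/funext => k; rewrite big_bool /= mul1r chain_cst // mulr1.
Qed.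

Lemma empirical_variance_ge0 (x : K -> R) : 0 <= empirical_variance x.
Proof. by rewrite mulr_ge0 ?invr_ge0 // sumr_ge0 // => i _; exact: sqr_ge0. Qed.

Lemma empirical_variance_le1 (x : K -> R) : (forall i, 0 <= x i <= 1) -> empirical_variance x <= 1.
Proof.
move=> hx.
suff /andP[_] : 0 <= torus_mean (fun i => (x i - torus_mean x) ^+ 2) <= 1 by [].
apply: torus_mean_bounds => // i; rewrite sqr_ge0 /=.
by apply: sqr_sub_le1 => //; exact: torus_mean_bounds.
Qed.

(** Law of the random set that contains each site independently with
    probability p. *)
Definition weight (p : R) S : R := \prod_k (if k \in S then p else 1 - p).

Lemma weight_ge0 p S : 0 <= p <= 1 -> 0 <= weight p S.
Proof.
by case/andP=> p0 p1; apply: prodr_ge0 => k _; case: ifP => // _; rewrite subr_ge0.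
Qed.

Lemma weight_sum p : \sum_S weight p S = 1.
Proof.
rewrite /weight -(bigA_distr _ _ (fun=> p) (fun=> 1 - p)) big1 // => k _.
exact: (subrKC p 1).
Qed.

Lemma weight_le p S : 0 <= p <= 1 -> (1 < #|S|)%N -> weight p S <= p ^+ 2.
Proof.
move=> /[dup] hp /andP[p0 p1] /card_gt1P[k [k' [kS k'S kk']]].
rewrite /weight (bigD1 k) //= (bigD1 k') /=; last by rewrite eq_sym.
rewrite kS k'S mulrA expr2 ler_piMr ?mulr_ge0 //.
by apply: prodr_ile1 => i _; case: ifP => _; rewrite ?p0 ?p1 // subr_ge0 p1 gerBl.
Qed.

Lemma weight1 p k : weight p [set k]%SET = p * (1 - p) ^+ (#|K|.-1).
Proof.
rewrite /weight (bigD1 k) //= inE eqxx; congr (_ * _).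
rewrite (eq_bigr (fun=> 1 - p)) => [|i /negPf ik]; last by rewrite inE ik.
by rewrite prodr_const cardC1.
Qed.

(** One step of the chain is driftless up to O(p ^ 2): the empty set changes
    nothing, singletons all have the same weight and cancel, and larger sets
    have weight at most p ^ 2. *)
Lemma weight_step p (g : (K -> R) -> R) (B : R) x : 0 <= p <= 1 -> 0 <= B ->
  (forall S, g (update S x) <= g x + B) ->
  \sum_k (g (update [set k]%SET x) - g x) = 0 ->
  \sum_S weight p S * g (update S x) <= g x + (#|{set K}|%:R * B) * p ^+ 2.
Proof.
move=> hp B0 gB gs.
have U0 : update finset.set0 x = x by apply/funext => k; rewrite /update inE.
have -> : \sum_S weight p S * g (update S x) =
    g x + \sum_S (weight p S * g (update S x) - weight p S * g x).
  by rewrite sumrB -mulr_suml weight_sum mul1r addrC subrK.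
rewrite lerD2l.
rewrite (bigID (fun S => (1 < #|S|)%N)) /= -[leRHS]addr0 lerD //.
  apply: (@le_trans _ _ (\sum_(S : {set K} | (1 < #|S|)%N) B * p ^+ 2)).
    apply: ler_sum => S hS; rewrite -mulrBr.
    apply: (@le_trans _ _ (weight p S * B)).
      by apply: ler_wpM2l; [exact: weight_ge0|rewrite lerBlDl].
    by rewrite mulrC; apply: ler_wpM2l => //; exact: weight_le.
  rewrite big_const iter_addr_0 -[leLHS]mulr_natl -[leRHS]mulrA; apply: ler_wpM2r.
    by rewrite mulr_ge0 // sqr_ge0.
  by rewrite ler_nat max_card.
rewrite (bigD1 finset.set0) /=; last by rewrite cards0.
rewrite U0 subrr add0r (eq_bigl (fun S : {set K} => #|S| == 1%N)); last first.
  by move=> S; rewrite -leqNgt -cards_eq0; case: #|S| => [|[|]].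
(* On singletons the choice of an element inverts the singleton map; the
   default 0 is never reached. *)
rewrite (reindex_onto (fun k : K => [set k]%SET)
   (fun S : {set K} => odflt 0 [pick k in S])) /=; last first.
  move=> S /cards1P[k ->]; congr ([set _]%SET); case: pickP => [k'|/(_ k)].
    by rewrite inE => /eqP.
  by rewrite inE eqxx.
rewrite (eq_bigl xpredT) => [|k]; last first.
  rewrite cards1 eqxx; case: pickP => [k'|/(_ k)]; first by rewrite inE.
  by rewrite inE eqxx.
under eq_bigr => k _ do rewrite -mulrBr weight1.
by rewrite -mulr_sumr gs mulr0.
Qed.

Lemma lyapunov_step p c x : 0 <= p <= 1 -> 0 <= c <= 1 -> (forall j, 0 <= x j <= 1) ->
  \sum_S weight p S * lyapunov c (update S x) <=
  lyapunov c x + (#|{set K}|%:R * lyapunov_bound) * p ^+ 2.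
Proof.
move=> hp hc hx; apply: weight_step => //; last exact: lyapunov_sum_update1.
  exact: le_trans (lyapunov_ge0 c x) (lyapunov_le hc hx).
move=> S; rewrite -[leLHS]add0r lerD ?lyapunov_ge0 // lyapunov_le //.
exact: update_bounds.
Qed.

(** Expectation of G over J independent random sets of law [weight p],
    conditioned one set at a time so that chain estimates go by induction. *)
Fixpoint expect (p : R) (J : nat) (G : seq {set K} -> R) : R :=
  if J is J'.+1 then \sum_S weight p S * expect p J' (fun l => G (S :: l)) else G [::].

Lemma le_expect p J G G' : 0 <= p <= 1 -> (forall l, G l <= G' l) -> expect p J G <= expect p J G'.
Proof.
move=> hp; elim: J G G' => [|J IH] G G' h /=; first exact: h.
by apply: ler_sum => S _; apply: ler_wpM2l; [exact: weight_ge0|exact: IH].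
Qed.

Lemma expect_cat p J1 J2 G :
  expect p (J1 + J2) G = expect p J1 (fun l1 => expect p J2 (fun l2 => G (l1 ++ l2))).
Proof. by elim: J1 G => [//|J1 IH] G /=; apply: eq_bigr => S _; rewrite IH. Qed.

Lemma expectD p J G G' : expect p J (fun l => G l + G' l) = expect p J G + expect p J G'.
Proof.
elim: J G G' => [//|J IH] G G' /=.
by rewrite -big_split; apply: eq_bigr => S _ /=; rewrite IH mulrDr.
Qed.

Lemma expectZ p J c G : expect p J (fun l => c * G l) = c * expect p J G.
Proof.
elim: J G => [//|J IH] G /=.
by rewrite mulr_sumr; apply: eq_bigr => S _ /=; rewrite IH mulrCA.
Qed.

Lemma expect_cst p J c : expect p J (fun=> c) = c.
Proof. by elim: J => [//|J IH] /=; rewrite IH -mulr_suml weight_sum mul1r. Qed.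

Lemma eq_expect p J G G' : (forall l, size l = J -> G l = G' l) -> expect p J G = expect p J G'.
Proof.
elim: J G G' => [|J IH] G G' h /=; first exact: h.
apply: eq_bigr => S _; congr (_ * _); apply: IH => l hl.
by apply: h; rewrite /= hl.
Qed.

Lemma lyapunov_expect p c J x : 0 <= p <= 1 -> 0 <= c <= 1 -> (forall j, 0 <= x j <= 1) ->
  expect p J (fun l => lyapunov c (chain l x)) <=
  lyapunov c x + J%:R * ((#|{set K}|%:R * lyapunov_bound) * p ^+ 2).
Proof.
move=> hp hc; elim: J x => [|J IH] x hx /=; first by rewrite mul0r addr0.
set q := _ * p ^+ 2.
apply: (@le_trans _ _ (\sum_S weight p S * (lyapunov c (update S x) + J%:R * q))).
  apply: ler_sum => S _; apply: ler_wpM2l; first exact: weight_ge0.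
  by apply: IH; exact: update_bounds.
under eq_bigr => S _ do rewrite mulrDr.
rewrite big_split /= -mulr_suml weight_sum mul1r.
have -> : lyapunov c x + J.+1%:R * q = lyapunov c x + q + J%:R * q by rewrite -natr1; ring.
by rewrite lerD2r; exact: lyapunov_step.
Qed.

(** Condition on the first J1 sets and apply the supermartingale bound to
    [lyapunov] centred at the mean reached by then, where its first term
    vanishes. *)
Lemma mean_increment_expect p J1 J2 x : 0 <= p <= 1 -> (forall j, 0 <= x j <= 1) ->
  expect p (J1 + J2) (fun l => (torus_mean (chain l x) -
     torus_mean (chain (take J1 l) x)) ^+ 2) <=
  (n ^ d)%:R^-1 * expect p J1 (fun l => energy (chain l x)) +
  J2%:R * ((#|{set K}|%:R * lyapunov_bound) * p ^+ 2).
Proof.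
move=> hp hx; rewrite expect_cat -expectZ -[X in _ + X](expect_cst p J1) -expectD.
rewrite [leLHS](@eq_expect _ _ _ (fun l1 => expect p J2 (fun l2 =>
   (torus_mean (chain l2 (chain l1 x)) - torus_mean (chain l1 x)) ^+ 2))); last first.
  by move=> l1 hl1; apply: eq_expect => l2 _; rewrite take_size_cat // chain_cat.
apply: le_expect => // l1; set x1 := chain l1 x.
have hx1 : forall j, 0 <= x1 j <= 1 by exact: chain_bounds.
apply: (@le_trans _ _ (expect p J2 (fun l2 => lyapunov (torus_mean x1) (chain l2 x1)))).
  apply: le_expect => // l2; rewrite lerDl mulr_ge0 ?energy_ge0 // invr_ge0.
apply: le_trans (lyapunov_expect _ hp (torus_mean_bounds hx1) hx1) _.
by rewrite lerD2r /lyapunov subrr expr0n add0r.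
Qed.

Definition translate (a : K) x : K -> R := fun k => x (k + a).

Lemma neighborD (a i j : K) : neighbor (i + a) (j + a) = neighbor i j.
Proof.
apply: eq_existsb => c; rewrite !ffunE; congr (_ && _).
  by rewrite !(addrAC _ (a c)) !(inj_eq (addIr _)) .
apply: eq_forallb => c'; congr (_ ==> _).
by rewrite !ffunE (inj_eq (addIr _)).
Qed.

Lemma sum_translate (a : K) (F : K -> R) : \sum_(k : K) F (k + a) = \sum_k F k.
Proof. by rewrite [RHS](reindex_inj (addIr a)). Qed.

Lemma ave_translate a x k : ave (translate a x) k = ave x (k + a).
Proof.
rewrite /ave; congr (_ * _); rewrite [RHS](reindex_inj (addIr a)) /=.
by apply: eq_bigl => j; rewrite neighborD.
Qed.

Lemma energy_translate a x : energy (translate a x) = energy x.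
Proof.
rewrite !energyE; congr (_ * _); rewrite -[RHS](sum_translate a).
by apply: eq_bigr => k _; rewrite ave_translate.
Qed.

Lemma torus_mean_translate a x : torus_mean (translate a x) = torus_mean x.
Proof. by rewrite /torus_mean -[in RHS](sum_translate a). Qed.

Lemma empirical_variance_translate a x : empirical_variance (translate a x) = empirical_variance x.
Proof.
rewrite /empirical_variance torus_mean_translate; congr (_ * _).
by rewrite -[RHS](sum_translate a).
Qed.

Lemma update_translate a S x :
  update S (translate a x) = translate a (update [set (k : K) + a | k in S]%SET x).
Proof.
apply/funext => k.
by rewrite /update ave_translate /translate -(mem_imset S k (addIr a)).
Qed.

Lemma weight_translate p a S : weight p [set (k : K) + a | k in S]%SET = weight p S.
Proof.
rewrite /weight (reindex_inj (addIr a)); apply: eq_bigr => k _.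
by rewrite -(mem_imset S k (addIr a)).
Qed.

(** Translating the starting configuration amounts to translating the random
    sets, whose law is invariant. *)
Lemma expect_translate p J a (G : (K -> R) -> R) x : (forall x, G (translate a x) = G x) ->
  expect p J (fun l => G (chain l (translate a x))) = expect p J (fun l => G (chain l x)).
Proof.
move=> hG; elim: J x => [|J IH] x /=; first exact: hG.
rewrite [RHS](reindex_inj (imset_inj (addIr a))) /=; apply: eq_bigr => S _.
rewrite weight_translate; congr (_ * _); rewrite /chain /= update_translate.
exact: IH.
Qed.

Definition delta (k : K) : K -> R := fun j => (j == k)%:R.

Lemma delta_bounds (k j : K) : 0 <= (delta k j : R) <= 1.
Proof. by rewrite /delta; case: (j == k); rewrite ?ler01 lexx. Qed.

Lemma translate_delta k : translate (- k) (delta 0) = delta k.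
Proof. by apply/funext => j; rewrite /translate /delta subr_eq0. Qed.

End averaging.

(** * Counting paths *)

Section counting.
Context {R : realType}.
Implicit Types (F : R -> nat) (s t T a b : R).

(** The infimum of the empty set is 0, so a level that is never reached has
    hitting time 0. *)
Definition hitting F (c : nat) : R := inf [set t | 0 <= t /\ (c <= F t)%N].

Section one.
Variable F : R -> nat.
Hypothesis cF : counting_path F.

Let F0 : F 0 = 0%N. Proof. by case: cF. Qed.
Let Fmono s t : 0 <= s -> s <= t -> (F s <= F t)%N. Proof. by case: cF => _ h _; exact: h. Qed.

Lemma hitting_has_inf c t : 0 <= t -> (c <= F t)%N ->
  has_inf [set t | 0 <= t /\ (c <= F t)%N].
Proof. by move=> t0 ct; split; [exists t|exists 0 => s []]. Qed.

Lemma hitting_ge0 c : 0 <= hitting F c.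
Proof.
rewrite /hitting; set A := (X in inf X).
have [->|/set0P Ane] := eqVneq A set0; first by rewrite inf0.
by apply: lb_le_inf => // s [].
Qed.

Lemma hitting_le c t : 0 <= t -> (c <= F t)%N -> hitting F c <= t.
Proof. by move=> t0 ct; apply: ge_inf; [case: (hitting_has_inf t0 ct)|split]. Qed.

Lemma lt_hitting c s : 0 <= s -> s < hitting F c -> (F s < c)%N.
Proof.
move=> s0 hs; rewrite ltnNge; apply/negP => /(hitting_le s0).
by rewrite leNgt hs.
Qed.

(** The infimum is attained by right-continuity. *)
Lemma hitting_attained c t : 0 <= t -> (c <= F t)%N -> (c <= F (hitting F c))%N.
Proof.
move=> t0 ct; have hi := hitting_has_inf t0 ct.
case: cF => _ _ /(_ _ (hitting_ge0 c)) [e /= e0 he].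
have [s [s0 cs] hs] := inf_adherent e0 hi.
have := ge_inf hi.2 (conj s0 cs); rewrite -/(hitting F c) le_eqVlt => /orP[/eqP ->//|lt].
rewrite -(he s) //= ltr_distlC ltrBlDr; apply/andP; split=> //.
by apply: lt_trans lt _; rewrite ltrDl.
Qed.

(** Integer values bounded by F t: the maximum over times before t is reached,
    and from then on monotonicity leaves no room. *)
Lemma left_constant t : 0 < t ->
  exists2 s, 0 <= s < t & forall u, s <= u -> u < t -> F u = F s.
Proof.
move=> t0.
pose P c := `[< exists2 s, 0 <= s < t & F s = c >].
have exP : exists c, P c by exists (F 0); apply/asboolP; exists 0 => //; rewrite lexx.
have ubP c : P c -> (c <= F t)%N.
  by move=> /asboolP[s /andP[s0 st] <-]; apply: Fmono => //; exact: ltW.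
case: (ex_maxnP exP ubP) => c /asboolP[s /andP[s0 st] Fs] mx.
exists s; rewrite ?s0 // => u su ut; apply/eqP; rewrite eqn_leq (Fmono s0 su) andbT Fs.
by apply: mx; apply/asboolP; exists u => //; rewrite ut (le_trans s0 su).
Qed.

(** At most one jump time tau in the interval; tau is the right endpoint when
    the path is constant. *)
Definition single_jump a b := exists2 tau, a < tau <= b &
  (forall s, a <= s -> s < tau -> F s = F a) /\ (forall s, tau <= s -> s <= b -> F s = F b).

Lemma single_jump_cst a b : 0 <= a -> a < b -> F a = F b -> single_jump a b.
Proof.
move=> a0 ab E; exists b; first by rewrite ab lexx.
split=> s h1 h2; first by apply/eqP; 
  rewrite eqn_leq (Fmono a0 h1) andbT E Fmono ?(ltW h2) // (le_trans a0).
by congr (F _); apply/eqP; rewrite eq_le h1 h2.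
Qed.

(** By induction on the level reached at T.  Before the time tau at which this
    level is reached, and after a left neighborhood where the path is constant,
    only tau itself can be a jump time; earlier intervals fall under the
    induction hypothesis at the point T' of that left neighborhood. *)
Lemma fine_single_jump T : 0 <= T -> exists2 e, 0 < e &
  forall a b, 0 <= a -> a < b -> b <= T -> b - a < e -> single_jump a b.
Proof.
have [c] := ubnP (F T); elim: c T => // c IH T; rewrite ltnS => FT T0.
set tau := hitting F (F T).
have Ftau : F tau = F T.
  apply/eqP; rewrite eqn_leq (hitting_attained T0) // andbT.
  by apply: Fmono; [exact: hitting_ge0|exact: hitting_le].
have tauT : tau <= T by exact: hitting_le.
have FtauT s : tau <= s -> s <= T -> F s = F T.
  move=> h1 h2; apply/eqP; rewrite eqn_leq Fmono ?(le_trans (hitting_ge0 _) h1) //=.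
  by rewrite -[X in (X <= _)%N]Ftau Fmono // hitting_ge0.
have := hitting_ge0 (F T); rewrite -/tau le_eqVlt => /orP[/eqP tau0|tau0].
  exists 1 => // a b a0 ab bT _; apply: single_jump_cst => //.
  by rewrite !FtauT -?tau0 // ?(ltW (le_lt_trans a0 ab)) // (le_trans (ltW ab)).
have [s /andP[s0 st] hs] := left_constant tau0.
pose T' := (s + tau) / 2.
have sT' : s < T' by rewrite /T'; lra.
have T't : T' < tau by rewrite /T'; lra.
have FT' : (F T' < F T)%N by apply: lt_hitting => //; lra.
have [//||e e0 he] := IH T'; first exact: leq_trans FT' FT.
  by lra.
exists (Num.min e (T' - s)); first by rewrite lt_min e0 subr_gt0.
move=> a b a0 ab bT; rewrite lt_min => /andP[be bs].
have [bT'|T'b] := leP b T'; first exact: he.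
have sa : s < a by lra.
have [tb|bt] := leP tau b; last first.
  by apply: single_jump_cst => //; rewrite !hs //; lra.
have [ta|ta] := leP tau a.
  by apply: single_jump_cst => //; rewrite !FtauT //; lra.
exists tau; first by rewrite ta tb.
split=> u h1 h2; first by rewrite !hs //; lra.
by rewrite !FtauT //; lra.
Qed.

End one.

Lemma counting_path_sum (I : finType) (f : I -> R -> nat) :
  (forall i, counting_path (f i)) -> counting_path (fun t => (\sum_i f i t)%N).
Proof.
move=> h; split.
- by rewrite big1 // => i _; case: (h i).
- by move=> s t s0 st; apply: leq_sum => i _; case: (h i) => _ m _; exact: m.
- move=> t t0.
  have : \forall s \near t^'+, forall i, f i s = f i t.
    by apply: filter_forall => i; case: (h i) => _ _; exact.
  by apply: filterS => s hs; apply: eq_bigr => i _.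
Qed.

(** Lets the superposition of all clocks detect the jumps of each of them. *)
Lemma counting_sum_cst (I : finType) (f : I -> R -> nat) s t :
  (forall i, counting_path (f i)) -> 0 <= s -> s <= t ->
  (\sum_i f i s = \sum_i f i t)%N -> forall i, f i s = f i t.
Proof.
move=> h s0 st E i.
have m j : (f j s <= f j t)%N by case: (h j) => _ m _; exact: m.
apply/eqP; rewrite eqn_leq m /= leqNgt; apply/negP => lt.
have : (\sum_i f i s < \sum_i f i t)%N.
  rewrite (bigD1 i) //= [X in (_ < X)%N](bigD1 i) //=.
  by rewrite -addSn leq_add // leq_sum.
by rewrite E ltnn.
Qed.

End counting.

(** * Paths of the smoothing process *)

Section paths.
Context {R : realType} {d n : nat}.
Local Notation K := (torus d n).
Variable f : K -> R -> nat.
Hypothesis cf : forall k, counting_path (f k).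
Let F t := (\sum_k f k t)%N.
Let cF : counting_path F. Proof. exact: counting_path_sum. Qed.

Definition ringing (a b : R) : {set K} := [set k | (f k b - f k a != 0)%N]%SET.

(** All rings of the interval happen at the same time tau, so each ringing site
    reads left limits equal to the values at the left endpoint. *)
Lemma smoothing_single_jump (y : K -> R -> R) a b : smoothing_path f y ->
  0 <= a -> single_jump F a b ->
  (fun k => y k b) = update (ringing a b) (fun k => y k a).
Proof.
move=> [ycst yring] a0 [tau /andP[atau taub] [h1 h2]].
have fmono k s t : 0 <= s -> s <= t -> (f k s <= f k t)%N by case: (cf k) => _ m _; exact: m.
have tau0 : 0 < tau by exact: le_lt_trans atau.
have fl k s : a <= s -> s < tau -> f k s = f k a.
  move=> sa st; apply/esym; apply: (counting_sum_cst cf) => //.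
  by apply/esym/h1.
have fr k s : tau <= s -> s <= b -> f k s = f k b.
  move=> sa st; apply: (counting_sum_cst cf) => //; first exact: le_trans (ltW tau0) sa.
  exact: h2.
have ftau k : f k tau = f k b by apply: fr.
have yl k s : a <= s -> s < tau -> y k s = y k a.
  move=> sa st; apply: ycst => // u au us [_ /(_ a a0 au)].
  by rewrite (fl k u) ?ltnn // ?(ltW au) // (le_lt_trans us).
have yr k : y k b = y k tau.
  apply: ycst => //; first exact: ltW.
  move=> u tu ub [_ /(_ tau (ltW tau0) tu)].
  by rewrite ftau (fr k u) ?ltnn // ltW.
apply/funext => k; rewrite /update inE subn_eq0 -ltnNge -ftau; case: ltnP => hk.
  rewrite yr yring; last first.
    split=> // s s0 st; apply: leq_ltn_trans hk.
    have [sa|/ltW sa] := leP a s; first by rewrite fl.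
    exact: fmono.
  congr (_ * _); apply: eq_bigr => j _; apply: cvg_lim => //.
  apply: cvg_near_cst; near=> s; apply: yl; near: s; last exact: nbhs_left_lt.
  exact: nbhs_left_ge.
rewrite yr; apply: ycst => //; first exact: ltW.
move=> u au; rewrite le_eqVlt => /orP[/eqP ->|ut] [_ /(_ a a0)]; first by move/(_ atau); rewrite ltnNge hk.
by move=> /(_ au); rewrite (fl k u) ?ltnn // ltW.
Unshelve. all: by end_near. Qed.

Lemma smoothing_grid (y : K -> R -> R) T : smoothing_path f y -> 0 <= T ->
  exists2 e, 0 < e & forall (u : nat -> R) J, 0 <= u 0%N -> u J <= T ->
    (forall j, u j < u j.+1) -> (forall j, u j.+1 - u j < e) ->
  (fun k => y k (u J)) = chain [seq ringing (u j) (u j.+1) | j <- iota 0 J] (fun k => y k (u 0%N)).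
Proof.
move=> hy T0; have [e e0 he] := fine_single_jump cF T0; exists e => // u J u0 uT um ue.
have umono i j : (i <= j)%N -> u i <= u j.
  by apply: (@homo_leq R u (fun a b => a <= b)) => //= [x y' z|j']; [exact: le_trans|exact: ltW].
elim: J uT => [//|J IH] uT.
rewrite -{2}addn1 iotaD map_cat chain_cat /= add0n -IH; last exact: le_trans (ltW (um J)) uT.
apply: smoothing_single_jump => //; first exact: le_trans (umono 0%N J isT).
by apply: he => //; exact: le_trans (umono 0%N J isT).
Qed.

(** Read off from a fine enough grid between a and b, as every averaging step
    keeps values in any interval. *)
Lemma smoothing_max_principle (y : K -> R -> R) a b lo hi : (1 <= d)%N -> (3 <= n)%N ->
  smoothing_path f y -> 0 <= a -> a <= b ->
  (forall k, lo <= y k a <= hi) -> forall k, lo <= y k b <= hi.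
Proof.
move=> d1 n3 hy a0; rewrite le_eqVlt => /orP[/eqP <- //|ab] h.
have [e e0 he] := smoothing_grid hy (le_trans a0 (ltW ab)).
pose m := (Num.truncn ((b - a) / e)).+1.
have m0 : 0 < m%:R :> R by rewrite ltr0n.
have hm : (b - a) / m%:R < e.
  rewrite ltr_pdivrMr // mulrC -ltr_pdivrMr //; exact: truncnS_gt.
pose u j := a + j%:R * ((b - a) / m%:R).
have uS j : u j.+1 - u j = (b - a) / m%:R by rewrite /u -natr1; ring.
have um : u m = b by rewrite /u mulrC divfK ?gt_eqF // addrC subrK.
have ua : u 0%N = a by rewrite /u mul0r addr0.
have := he u m; rewrite ua um => /(_ a0 (lexx b)) E k.
suff -> : y k b = chain [seq ringing (u j) (u j.+1) | j <- iota 0 m] (fun k => y k a) k.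
  exact: chain_bounds.
rewrite -E //.
  by move=> j; rewrite -subr_gt0 uS divr_gt0 // subr_gt0.
by move=> j; rewrite uS.
Qed.

Variable y0 : K -> R.

(** Sites that ring when the total count reaches c.  It is empty when the total
    count jumps over c, which happens when several clocks ring at once or one
    of them jumps by more than 1. *)
Definition level_rings (c : nat) : {set K} :=
  [set k | `[< F (hitting F c) = c /\ rings (f k) (hitting F c) >]]%SET.

(** Configuration while the total count is c. *)
Fixpoint level_state (c : nat) : K -> R :=
  if c is c'.+1 then update (level_rings c) (level_state c') else y0.

Definition solution (k : K) (t : R) : R := level_state (F t) k.

Lemma solution0 k : solution k 0 = y0 k.
Proof. by rewrite /solution; case: cF => ->. Qed.

(** Levels whose ring sets avoid the sites in P leave these sites alone. *)
Lemma level_state_cst (P : pred K) c c' : (c <= c')%N ->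
  (forall k e, P k -> (c < e <= c')%N -> k \notin level_rings e) ->
  forall k, P k -> level_state c' k = level_state c k.
Proof.
move=> /subnKC <-; elim: (c' - c)%N => [|m IH] h k Pk; first by rewrite addn0.
rewrite addnS /= /update ifN; last by apply: h => //; rewrite addnS ltnS leq_addr /=.
by apply: IH => // k' e Pk' /andP[h1 h2]; apply: h => //; rewrite h1 addnS leqW.
Qed.

(** The value at k changes only at levels where k rings.  At a ring time t the
    total count jumps from some value straight to F t; the skipped levels have
    no ring set, so the update at level F t reads the left limits. *)
Lemma solution_smoothing : smoothing_path f solution.
Proof.
have Fmono s t : 0 <= s -> s <= t -> (F s <= F t)%N by case: cF => _ m _; exact: m.
split=> [k s t s0 st hr|k t [t0 hr]].
  have t0 := le_trans s0 st.
  apply: (@level_state_cst (pred1 k)) => //=; first exact: Fmono.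
  move=> k' e /eqP -> {k'} /andP[h1 h2]; rewrite inE; apply/asboolP => -[h3 h4].
  apply: hr h4; last exact: hitting_le.
  rewrite lt_neqAle; apply/andP; split.
    by apply/eqP => E; move: h1; rewrite E h3 ltnn.
  rewrite leNgt; apply/negP => /ltW hs.
  have := Fmono _ _ (hitting_ge0 F e) hs.
  by rewrite h3 leqNgt h1.
have Flt s : 0 <= s -> s < t -> (F s < F t)%N.
  move=> s0 st; rewrite /F (bigD1 k) //= [X in (_ < X)%N](bigD1 k) //= -addSn leq_add //.
    exact: hr.
  by apply: leq_sum => i _; case: (cf i) => _ m _; apply: m => //; exact: ltW.
have [s /andP[s0 st] hs] := left_constant cF t0.
have hit e : (F s < e <= F t)%N -> hitting F e = t.
  move=> /andP[h1 h2]; apply/eqP; rewrite eq_le hitting_le ?(ltW t0) //=.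
  rewrite leNgt; apply/negP => lt.
  have := hitting_attained cF (ltW t0) h2; rewrite leqNgt => /negP; apply.
  have [sh|/ltW hsh] := leP s (hitting F e); first by rewrite hs.
  by apply: leq_ltn_trans h1; apply: Fmono => //; exact: hitting_ge0.
have Fst := Flt s s0 st.
have Et : (F t = (F t).-1.+1)%N by rewrite prednK // (leq_ltn_trans _ Fst).
rewrite /solution {1}Et /= -Et /update ifT; last first.
  rewrite inE; apply/asboolP; rewrite hit ?leqnn ?Fst //.
congr (_ * _); apply: eq_bigr => j _; apply/esym/cvg_lim => //.
rewrite (@level_state_cst xpredT (F s)) //.
- apply: cvg_near_cst; near=> u; congr (level_state _ j); apply: hs.
    near: u; exact: nbhs_left_ge.
  near: u; exact: nbhs_left_lt.
- by rewrite -ltnS -Et.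
move=> i e _ /andP[h1 h2]; rewrite inE; apply/asboolP => -[].
have et : (e < F t)%N by rewrite Et ltnS.
by rewrite hit ?h1 1?ltnW // => h3; move: et; rewrite -h3 ltnn.
Unshelve. all: by end_near. Qed.

End paths.

(** * Integrals of functions not known to be measurable *)

Section integrals.
Context {dsp : measure_display} {Om : measurableType dsp} {R : realType}.
Variable P : probability Om R.
Local Open Scope ereal_scope.

Import HBNNSimple.

(** The integral of a nonnegative function is a supremum over the simple
    functions below it.  The median and the limit of the mean enter integrands
    without a proof of measurability, which is why this form is useful. *)
Lemma le_integral_nonmeasurable (f g : Om -> \bar R) :
  (forall w, 0 <= f w) -> (forall w, 0 <= g w) -> (forall w, f w <= g w) ->
  \int[P]_w f w <= \int[P]_w g w.
Proof.
move=> f0 g0 fg; rewrite !ge0_integralTE //; apply: le_ereal_sup => _ [h hf <-].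
by exists h => // w; exact: le_trans (hf w) (fg w).
Qed.

Lemma ae_le_integral_nonmeasurable (f g : Om -> \bar R) :
  (forall w, 0 <= f w) -> (forall w, 0 <= g w) -> measurable_fun setT g ->
  {ae P, forall w, f w <= g w} -> \int[P]_w f w <= \int[P]_w g w.
Proof.
move=> f0 g0 mg fg; rewrite [leLHS]ge0_integralTE //.
apply: ge_ereal_sup => _ [h hf <-].
rewrite (_ : sintegral P h = \int[P]_w (h w)%:E); last first.
  by rewrite integralT_nnsfun.
apply: ae_ge0_le_integral => //.
- by move=> w _; rewrite lee_fin.
- by apply/measurable_EFinP; exact: measurable_funPT.
- by apply: filterS fg => w hw _; exact: le_trans (hf w) hw.
Qed.

(** Dividing the measurable side by c avoids scaling the integral of H, whose
    measurability is not assumed. *)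
Lemma le_integral_scale (f H : Om -> R) (c : R) : (0 <= c)%R ->
  measurable_fun setT f -> (forall w, 0 <= f w)%R -> (forall w, 0 <= H w)%R ->
  (forall w, f w <= c * H w)%R ->
  \int[P]_w (f w)%:E <= c%:E * \int[P]_w (H w)%:E.
Proof.
move=> c0 mf f0 H0 fH; move: c0; rewrite le_eqVlt => /orP[/eqP c0|c0].
  rewrite -c0 mul0e (eq_integral (cst 0)) ?integral0 // => w _.
  by congr EFin; apply/eqP; rewrite eq_le f0 andbT -(mul0r (H w)) c0.
have -> : \int[P]_w (f w)%:E = c%:E * \int[P]_w (c^-1 * f w)%:E.
  rewrite -ge0_integralZl //; last 3 first.
  - by apply/measurable_EFinP; exact: measurable_funM.
  - by move=> w _; rewrite lee_fin mulr_ge0 // invr_ge0 ltW.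
  - by rewrite lee_fin ltW.
  by apply: eq_integral => w _; rewrite -EFinM mulrA divff ?mul1r ?gt_eqF.
apply: lee_wpmul2l; first by rewrite lee_fin ltW.
apply: le_integral_nonmeasurable => w; rewrite lee_fin //.
  by rewrite mulr_ge0 // invr_ge0 ltW.
by rewrite ler_pdivrMl.
Qed.

Lemma measurable_fun_limn_einf (f : (Om -> \bar R)^nat) :
  (forall n, measurable_fun setT (f n)) ->
  measurable_fun setT (fun w => limn_einf (f ^~ w)).
Proof.
move=> mf; rewrite (_ : (fun _ => _) = (fun w => - limn_esup (fun n => - f n w))).
  apply: measurableT_comp => //; apply: (@measurable_fun_limn_esup _ _ _ _ (fun n w => - f n w)).
  by move=> n; exact: measurableT_comp.
by apply/funext => w; rewrite -limn_einfN; congr limn_einf; apply/funext => n /=; rewrite oppeK.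
Qed.

(** The limit function need not be measurable: it agrees almost everywhere with
    the measurable lower limit, which dominates every simple function below
    it. *)
Lemma fatou_ae (f_ : nat -> Om -> R) (f : Om -> R) (c_ : nat -> \bar R) (c : \bar R) :
  (forall n, measurable_fun setT (f_ n)) ->
  (forall n w, 0 <= f_ n w)%R -> (forall w, 0 <= f w)%R ->
  {ae P, forall w, f_ n w @[n --> \oo] --> f w} ->
  (forall n, \int[P]_w (f_ n w)%:E <= c_ n) -> c_ n @[n --> \oo] --> c ->
  \int[P]_w (f w)%:E <= c.
Proof.
move=> mf f_0 f0 cvf fc cc.
have mEf n : measurable_fun setT (fun w => (f_ n w)%:E) by apply/measurable_EFinP.
apply: (@le_trans _ _ (\int[P]_w limn_einf (fun n => (f_ n w)%:E))).
  apply: ae_le_integral_nonmeasurable.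
  - by move=> w; rewrite lee_fin.
  - move=> w; rewrite limn_einf_lim; apply: lime_ge; first exact: is_cvg_einfs.
    by apply: nearW => n; apply: le_ereal_inf_tmp => _ [m _ <-]; rewrite lee_fin.
  - exact: (measurable_fun_limn_einf (f := fun n w => (f_ n w)%:E)).
  - apply: filterS cvf => w hw.
    have h : (f_ n w)%:E @[n --> \oo] --> (f w)%:E by apply: cvg_EFin; [exact: nearW|exact: hw].
    by have [-> _] := cvg_limn_einf_sup h.
apply: le_trans.
  by apply: fatou => // n w _; rewrite lee_fin.
have [hc _] := cvg_limn_einf_sup cc.
rewrite -hc !limn_einf_lim; apply: lee_lim; try exact: is_cvg_einfs.
apply: nearW => n; apply: le_ereal_inf_tmp => _ [m nm <-].
by apply: le_trans (fc m); apply: ereal_inf_lbound; exists m.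
Qed.

(** The infimum of the sequence is integrable with integral 0. *)
Lemma ae_small_of_integral (f_ : nat -> Om -> R) :
  (forall n, measurable_fun setT (f_ n)) -> (forall n w, 0 <= f_ n w)%R ->
  \int[P]_w (f_ n w)%:E @[n --> \oo] --> 0 ->
  {ae P, forall w, forall e : R, (0 < e)%R -> exists n, (f_ n w < e)%R}.
Proof.
move=> mf f_0 cv; pose g w := einfs (fun n => (f_ n w)%:E) 0%N.
have g0 w : 0 <= g w.
  by apply: le_ereal_inf_tmp => _ [m _ <-]; rewrite lee_fin.
have mg : measurable_fun setT g.
  apply: (@measurable_fun_einfs _ _ _ _ (fun n w => (f_ n w)%:E)) => n.
  exact/measurable_EFinP.
have ig : \int[P]_w `|g w| = 0.
  apply/eqP; rewrite eq_le integral_ge0 ?andbT; last by move=> w _; exact: abse_ge0.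
  rewrite -(cvg_lim (@ereal_hausdorff R) cv); apply: lime_ge; first by apply/cvg_ex; exists 0.
  apply: nearW => n; apply: le_integral_nonmeasurable => w.
  - exact: abse_ge0.
  - by rewrite lee_fin.
  - by rewrite gee0_abs //; apply: ereal_inf_lbound; exists n.
have := (ae_eq_integral_abs P measurableT mg).1 ig.
apply: filterS => w /(_ I) gw e e0.
have : einfs (fun n => (f_ n w)%:E) 0%N < e%:E by rewrite -/(g w) gw lte_fin.
by move=> /ereal_inf_lt[_ [m _ <-]]; rewrite lte_fin => ?; exists m.
Qed.

End integrals.

(** * Independence of the clocks and of the initial configuration *)

(** Stated for any measurable space, so that it applies both to the ambient
    sigma-algebra and to the one generated by a single clock. *)
Lemma measurable_increment {dsp : measure_display} {T : measurableType dsp}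
    (f g : T -> nat) (b : bool) :
  measurable_fun setT f -> measurable_fun setT g ->
  measurable [set w | (g w - f w != 0)%N = b].
Proof.
move=> mf mg.
have m0 : measurable [set w | (g w <= f w)%N].
  rewrite (_ : [set w | _] = \bigcup_a (f @^-1` [set a] `&` g @^-1` [set c | (c <= a)%N])).
    apply: bigcup_measurable => a _; rewrite -[X in measurable X]setTI setIIr.
    by apply: measurableI; [apply: mf|apply: mg].
  apply/seteqP; split => [w /= h|w [a _ [/= -> //]]].
  by exists (f w).
case: b; last first.
  rewrite (_ : [set w | _] = [set w | (g w <= f w)%N]) //.
  by apply/seteqP; split => w /=; rewrite subn_eq0; [move/negbFE|move=> ->].
rewrite (_ : [set w | _] = ~` [set w | (g w <= f w)%N]); first exact: measurableC.
by apply/seteqP; split => w /=; rewrite subn_eq0; [move=> /negP|move=> /negP ->].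
Qed.

Section independent_event.
Context {dsp : measure_display} {Om : measurableType dsp} {R : realType}.
Variable P : probability Om R.
Variable G : set (set Om).
Hypothesis mG : forall A, <<s G >> A -> measurable A.
Variables (B : set Om) (b : R).
Hypothesis mB : measurable B.
Hypothesis b0 : 0 <= b.
Hypothesis hB : forall A, <<s G >> A -> P (A `&` B) = (b%:E * P A)%E.

Lemma measurable_fun_generated (f : Om -> R) :
  measurable_fun (setT : set (g_sigma_algebraType G)) f -> measurable_fun (setT : set Om) f.
Proof. by move=> mf _ U mU; apply: mG; exact: mf. Qed.

(** Pushing the restriction of P to B forward to the sigma-algebra generated by
    G gives a multiple of P there, by independence. *)
Lemma integral_independent_event (f : Om -> R) :
  measurable_fun (setT : set (g_sigma_algebraType G)) f -> (forall w, 0 <= f w) ->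
  (\int[P]_(w in B) (f w)%:E = b%:E * \int[P]_w (f w)%:E)%E.
Proof.
move=> mf f0.
have mEf : measurable_fun (setT : set (g_sigma_algebraType G)) (EFin \o f).
  exact/measurable_EFinP.
have mEf' : measurable_fun (setT : set Om) (EFin \o f).
  by apply/measurable_EFinP; exact: measurable_fun_generated.
have mid : measurable_fun (setT : set Om) (idfun : Om -> g_sigma_algebraType G).
  by move=> _ A mA; rewrite setTI; exact: mG.
pose nu := mrestr P mB.
have -> : (\int[P]_(w in B) (f w)%:E = \int[nu]_w (f w)%:E)%E.
  rewrite -[in RHS](setUv B) ge0_integral_setU //=; last 4 first.
  - exact: measurableC.
  - by rewrite setUv.
  - by move=> w _; rewrite lee_fin.
  - by rewrite disj_set2E setICr.
  rewrite [X in (_ + X)%E](_ : _ = 0%E) ?adde0.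
    by apply: eq_measure_integral => A mA AB /=; rewrite /nu /= /mrestr (setIidl AB).
  apply: null_set_integral => //; first exact: measurableC.
    by apply: measurable_funTS.
  by rewrite /nu /= /mrestr setICl measure0.
have push (mu : {measure set Om -> \bar R}) :
    (\int[mu]_w (f w)%:E = \int[pushforward mu (idfun : Om -> g_sigma_algebraType G)]_w (f w)%:E)%E.
  rewrite (ge0_integral_pushforward mid) //; last by move=> w _; rewrite lee_fin.
rewrite (push nu) (push P).
rewrite -(ge0_integral_mscale _ measurableT (NngNum b0) mEf); last first.
  by move=> w _; rewrite lee_fin.
apply: eq_measure_integral => A mA _.
exact: hB.
Qed.
End independent_event.

Section law.
Context {R : realType} {dsp : measure_display} {Om : measurableType dsp}.
Context {P : probability Om R} {d n : nat}.
Local Notation K := (torus d n).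
Variables (N : K -> R -> {RV P >-> nat}) (Y : K -> R -> {RV P >-> R}).
Hypothesis proc : smoothing_process N Y.

Definition clock_paths (w : Om) : K -> R -> nat := fun k t => N k t w.

Definition ring_sets (h : R) (J : nat) (w : Om) : seq {set K} :=
  [seq ringing (clock_paths w) (j%:R * h) (j.+1%:R * h) | j <- iota 0 J].

Variable h : R.
Hypothesis h0 : 0 < h.
Let u (j : nat) : R := j%:R * h.
Let p : R := 1 - expR (- h).

Lemma rate_bounds : 0 <= p <= 1.
Proof.
rewrite /p subr_ge0 lerBlDr lerDl expR_ge0 andbT.
by rewrite -(expR0 R) ler_expR oppr_le0 ltW.
Qed.

Let u_ge0 j : 0 <= u j. Proof. by rewrite /u mulr_ge0 // ltW. Qed.
Let uS j : u j < u j.+1. Proof. by rewrite /u ltr_pM2r // ltr_nat. Qed.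

Definition increment_event (k : K) (j : nat) (b : bool) : set Om :=
  [set w | (N k (u j.+1) w - N k (u j) w != 0)%N = b].

Lemma increment_event_generated k j b :
  driving_sigma N Y (Some k) (increment_event k j b).
Proof.
pose G := \bigcup_(t in [set t : R | 0 <= t]) preimage_set_system setT (N k t) measurable.
have mN t : 0 <= t -> measurable_fun (setT : set (g_sigma_algebraType G)) (N k t : Om -> nat).
  move=> t0 _ U mU; apply: sub_gen_smallest; exists t => //.
  by exists U.
exact: (@measurable_increment _ (g_sigma_algebraType G) _ _ b (mN _ (u_ge0 j)) (mN _ (u_ge0 j.+1))).
Qed.

Lemma measurable_increment_event k j b : measurable (increment_event k j b).
Proof. by apply: measurable_increment; exact: measurable_funPT. Qed.

Lemma increment_event_law k j b : P (increment_event k j b) = (if b then p else 1 - p)%:E.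
Proof.
have Pf : P (increment_event k j false) = (expR (- h))%:E.
  rewrite (_ : increment_event _ _ _ = [set w | (N k (u j.+1) w - N k (u j) w)%N = 0%N]).
    rewrite (poisson_law (smoothing_clocks proc k)) //.
    rewrite (_ : u j.+1 - u j = h); last by rewrite /u -natr1; ring.
    by rewrite /poisson_pmf h0 expr0 fact0 divr1 mul1r.
  by apply/seteqP; split => w; rewrite /increment_event /=; [move/negbFE/eqP|move=> ->].
case: b; last by rewrite Pf /p opprB addrC subrK.
rewrite (_ : increment_event _ _ _ = ~` increment_event k j false).
  by rewrite probability_setC ?Pf -?EFinB //; exact: measurable_increment_event.
by apply/seteqP; split => w; rewrite /increment_event /=; case: (_ != _).
Qed.

(** Independence of increments handles each clock, independence of the clocks
    and of the initial configuration handles the rest; the event is a product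
    over sites and intervals. *)
Lemma ring_sets_law (s : seq {set K}) (A : set Om) : driving_sigma N Y None A ->
  P (A `&` [set w | ring_sets h (size s) w = s]) =
  ((\prod_(S <- s) weight p S)%:E * P A)%E.
Proof.
move=> hA; set J := size s.
pose Jn : {fset nat} := seq_fset tt (iota 0 J).
pose B k : set Om := \bigcap_(j in [set` Jn]) increment_event k j (k \in nth finset.set0 s j).
(* The event splits into one factor for the initial configuration and one
   for each clock. *)
pose ks : seq (option K) := None :: [seq Some k | k <- enum {: K}].
pose Ko : {fset option K} := seq_fset tt ks.
pose Ao o := match o with None => A | Some k => B k end.
have EJ j : [set` Jn] j <-> (j < J)%N by rewrite /= /Jn seq_fsetE mem_iota.
have hE : A `&` [set w | ring_sets h J w = s] = \bigcap_(o in [set` Ko]) Ao o.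
  apply/seteqP; split => [w [wA /= ws] [k|] _ //= j /EJ jJ|w hw].
    by rewrite /increment_event /= -[in RHS]ws (nth_map 0%N) ?size_iota // nth_iota // add0n inE.
  split; first by apply: (hw None); rewrite /= /Ko seq_fsetE inE.
  apply: (@eq_from_nth _ finset.set0); first by rewrite size_map size_iota.
  move=> j; rewrite size_map size_iota => jJ.
  rewrite (nth_map 0%N) ?size_iota // nth_iota // add0n; apply/setP => k; rewrite inE.
  have kKo : [set` Ko] (Some k).
    by rewrite /= /Ko seq_fsetE inE /=; apply/mapP; exists k => //; rewrite mem_enum.
  exact: (hw (Some k) kKo j ((EJ j).2 jJ)).
rewrite hE (smoothing_indep proc); last first.
  move=> [k|] _ //=; rewrite /B.
  pose G := \bigcup_(t in [set t : R | 0 <= t]) preimage_set_system setT (N k t) measurable.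
  apply: (@bigcap_measurableType _ (g_sigma_algebraType G)) => // j _.
  exact: increment_event_generated.
rewrite (perm_big ks); last first.
  apply: (@perm_trans _ (undup ks)); first exact: seq_fset_perm.
  rewrite undup_id //= map_inj_uniq ?enum_uniq ?andbT.
    by apply/mapP => -[].
  by move=> ? ? [].
rewrite big_cons big_map muleC; congr (_ * _)%E.
have PB k : P (B k) = (\prod_(0 <= j < J) (if k \in nth finset.set0 s j then p else 1 - p))%:E.
  rewrite /B (poisson_indep (smoothing_clocks proc k) (u := u)) //; last 2 first.
  - by move=> j; exact: ltW.
  - move=> j _; exists [set v : nat | (v != 0)%N = (k \in nth finset.set0 s j)] => //.
    by rewrite setTI.
  rewrite (perm_big (index_iota 0 J)); last first.
    apply: (@perm_trans _ (undup (iota 0 J))); first exact: seq_fset_perm.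
    by rewrite /index_iota subn0 undup_id ?iota_uniq.
  rewrite -prodEFin; apply: eq_bigr => j _; exact: increment_event_law.
rewrite (eq_bigr _ (fun k _ => PB k)) prodEFin; congr EFin.
rewrite big_enum /= exchange_big /= [RHS](big_nth finset.set0).
by apply: eq_bigr.
Qed.

End law.

(** * Integrals over the ring sets *)

Lemma sum_cons_tuple (V : nmodType) (T : finType) (J : nat) (F : seq T -> V) :
  \sum_(s : J.+1.-tuple T) F s = \sum_(x : T) \sum_(s : J.-tuple T) F (x :: s).
Proof.
rewrite pair_big /= (reindex (fun q : T * J.-tuple T => [tuple of q.1 :: q.2])) //=.
exists (fun s : J.+1.-tuple T => (thead s, [tuple of behead s])) => [[x s] _|s _] /=.
  by congr pair; apply: val_inj.
by rewrite [RHS]tuple_eta; apply: val_inj.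
Qed.

(** The unconditioned form of the expectation, suited to comparison with the
    joint law of the clocks. *)
Lemma expect_tuple (R : realType) (d n : nat) (p : R) J (G : seq {set torus d n} -> R) :
  expect p J G = \sum_(s : J.-tuple {set torus d n}) (\prod_(S <- s) weight p S) * G s.
Proof.
elim: J G => [|J IH] G /=.
  rewrite (big_pred1 [tuple]) => [|s]; first by rewrite big_nil mul1r.
  by apply/esym/eqP; exact: tuple0.
rewrite (sum_cons_tuple _ (fun s => (\prod_(S <- s) weight p S) * G s)).
apply: eq_bigr => S _; rewrite IH mulr_sumr; apply: eq_bigr => s _.
by rewrite big_cons mulrA.
Qed.

Lemma expect_sum (R : realType) (d n : nat) (p : R) J (I : finType)
    (F : I -> seq {set torus d n} -> R) :
  expect p J (fun l => \sum_i F i l) = \sum_i expect p J (F i).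
Proof.
elim: J F => [//|J IH] F /=.
under eq_bigr => S _ do rewrite (IH (fun i l => F i (S :: l))) mulr_sumr.
by rewrite exchange_big.
Qed.

Lemma measurable_map_fiber {dsp : measure_display} {T : measurableType dsp} {X : eqType}
    (I : Type) (f : I -> T -> X) (l : seq I) (s : seq X) :
  (forall i x, measurable [set w | f i w = x]) -> measurable [set w | [seq f i w | i <- l] = s].
Proof.
move=> mf; elim: l s => [|i l IH] [|x s] /=.
- by rewrite (_ : [set _ | _] = setT) //; apply/seteqP; split.
- by rewrite (_ : [set _ | _] = set0) //; apply/seteqP; split.
- by rewrite (_ : [set _ | _] = set0) //; apply/seteqP; split.
rewrite (_ : [set _ | _] = [set w | f i w = x] `&` [set w | [seq f i w | i <- l] = s]).
  exact: measurableI.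
by apply/seteqP; split => w /= [-> ->].
Qed.

(** Cauchy-Schwarz inequality for the weights |z i|, from 2 a b <= a ^ 2 + b ^
    2. *)
Lemma sqr_sum_le (R : realType) (I : finType) (z G : I -> R) :
  (\sum_i z i * G i) ^+ 2 <= (\sum_i `|z i|) * \sum_i `|z i| * G i ^+ 2.
Proof.
have -> : (\sum_i z i * G i) ^+ 2 = \sum_i \sum_j (z i * G i) * (z j * G j).
  by rewrite expr2 mulr_suml; apply: eq_bigr => i _; rewrite mulr_sumr.
have -> : (\sum_i `|z i|) * (\sum_i `|z i| * G i ^+ 2) =
    \sum_i \sum_j (`|z i| * `|z j|) * ((G i ^+ 2 + G j ^+ 2) / 2).
  have E : (\sum_i `|z i|) * (\sum_i `|z i| * G i ^+ 2) =
      \sum_i \sum_j (`|z i| * `|z j|) * G j ^+ 2.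
    by rewrite mulr_suml; apply: eq_bigr => i _; rewrite mulr_sumr; apply: eq_bigr => j _; rewrite mulrA.
  have E' : (\sum_i `|z i|) * (\sum_i `|z i| * G i ^+ 2) =
      \sum_i \sum_j (`|z i| * `|z j|) * G i ^+ 2.
    rewrite E exchange_big; apply: eq_bigr => i _; apply: eq_bigr => j _.
    by rewrite (mulrC `|z j|).
  have half (X a b : R) : X = a -> X = b -> X = (a + b) / 2 by lra.
  rewrite (half _ _ _ E' E) -big_split mulr_suml; apply: eq_bigr => i _ /=.
  by rewrite -big_split mulr_suml; apply: eq_bigr => j _ /=; lra.
apply: ler_sum => i _; apply: ler_sum => j _.
apply: (le_trans (ler_norm _)); rewrite !normrM mulrACA; apply: ler_wpM2l.
  by rewrite mulr_ge0.
rewrite -[G i ^+ 2]real_normK ?num_real // -[G j ^+ 2]real_normK ?num_real //.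
move: (`|G i|) (`|G j|) => a b; have := sqr_ge0 (a - b); nra.
Qed.

Section integral_ring_sets.
Context {R : realType} {dsp : measure_display} {Om : measurableType dsp}.
Context {P : probability Om R} {d n : nat}.
Local Notation K := (torus d n).
Variables (N : K -> R -> {RV P >-> nat}) (Y : K -> R -> {RV P >-> R}).
Hypothesis proc : smoothing_process N Y.
Variable h : R.
Let p : R := 1 - expR (- h).

Lemma measurable_ringing (a b : R) (S : {set K}) :
  measurable [set w | ringing (clock_paths N w) a b = S].
Proof.
rewrite (_ : [set w | _] = \bigcap_(k in [set: K])
    [set w | (N k b w - N k a w != 0)%N = (k \in S)]).
  apply: fin_bigcap_measurable => [|k _]; first exact: finite_finset.
  by apply: measurable_increment; exact: measurable_funPT.
apply/seteqP; split => [w /= <- k _ /=|w hw]; first by rewrite inE.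
by apply/setP => k; rewrite inE; exact: hw.
Qed.

Lemma measurable_ring_sets J s : measurable [set w | ring_sets N h J w = s].
Proof.
apply: (@measurable_map_fiber _ _ _ _
  (fun j w => ringing (clock_paths N w) (j%:R * h) (j.+1%:R * h))) => j S.
exact: measurable_ringing.
Qed.

Lemma ring_sets_decomp J (Phi : seq {set K} -> Om -> R) w :
  (Phi (ring_sets N h J w) w)%:E =
  (\sum_(s : J.-tuple {set K}) ((EFin \o Phi s) \_ [set w | ring_sets N h J w = s]) w)%E.
Proof.
have sJ : size (ring_sets N h J w) == J by rewrite size_map size_iota.
rewrite (bigD1 (Tuple sJ)) //= patchT ?inE //= big1 ?adde0 // => s sne.
rewrite patchN //; apply/negP; rewrite inE /= => E.
by case/eqP: sne; apply: val_inj; rewrite /= E.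
Qed.

Lemma measurable_ring_sets_fun J (Phi : seq {set K} -> Om -> R) :
  (forall l, measurable_fun setT (Phi l)) ->
  measurable_fun setT (fun w => Phi (ring_sets N h J w) w).
Proof.
move=> mPhi; apply/measurable_EFinP.
rewrite (_ : _ \o _ = (fun w => \sum_(s : J.-tuple {set K})
    ((EFin \o Phi s) \_ [set w | ring_sets N h J w = s]) w)%E); last first.
  by apply/funext => w /=; exact: ring_sets_decomp.
apply: emeasurable_sum => s _; apply/(measurable_restrictT _ _).1 => //.
  exact: measurable_ring_sets.
by apply/measurable_EFinP; exact: measurable_funTS.
Qed.

Definition initial_sigma : set (set Om) :=
  \bigcup_(i in [set: K]) preimage_set_system setT (fun w => Y i 0 w) measurable.

Hypothesis h0 : 0 < h.

Lemma initial_sigma_measurable A : <<s initial_sigma >> A -> measurable A.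
Proof.
apply: smallest_sub; first exact: sigma_algebra_measurable.
by move=> _ [i _ [U mU <-]]; exact: measurable_funPT.
Qed.

(** Conditioning on the initial configuration: the ring sets keep their law, so
    they can be averaged out first. *)
Lemma integral_ring_sets J (Phi : seq {set K} -> Om -> R) :
  (forall l, measurable_fun (setT : set (g_sigma_algebraType initial_sigma)) (Phi l)) ->
  (forall l w, 0 <= Phi l w) ->
  (\int[P]_w (Phi (ring_sets N h J w) w)%:E =
   \int[P]_w (expect p J (fun l => Phi l w))%:E)%E.
Proof.
move=> mPhi Phi0.
have W0 (s : seq {set K}) : 0 <= \prod_(S <- s) weight p S.
  by apply: prodr_ge0 => S _; apply: weight_ge0; exact: rate_bounds.
have mPhi' l : measurable_fun (setT : set Om) (EFin \o Phi l).
  apply/measurable_EFinP; apply: measurable_fun_generated (mPhi l).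
  exact: initial_sigma_measurable.
transitivity (\sum_(s : J.-tuple {set K})
    ((\prod_(S <- s) weight p S)%:E * \int[P]_w (Phi s w)%:E))%E.
  under eq_integral => w _ do rewrite ring_sets_decomp.
  rewrite ge0_integral_sum //; last 2 first.
  - move=> s; apply/(measurable_restrictT _ _).1 => //; first exact: measurable_ring_sets.
    exact: measurable_funTS.
  - by move=> s w _; rewrite /patch; case: ifP => // _; rewrite lee_fin.
  apply: eq_bigr => s _; rewrite -integral_mkcond.
  apply: (@integral_independent_event _ _ _ P initial_sigma) => //.
  - exact: initial_sigma_measurable.
  - exact: measurable_ring_sets.
  - move=> A hA; rewrite -{1}(size_tuple s).
    exact: (ring_sets_law proc h0 s hA).
under [RHS]eq_integral => w _ do rewrite expect_tuple -sumEFin.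
rewrite ge0_integral_sum //; last 2 first.
- by move=> s; apply/measurable_EFinP; apply: measurable_funM => //; exact/measurable_EFinP.
- by move=> s w _; rewrite lee_fin mulr_ge0.
apply: eq_bigr => s _; under [RHS]eq_integral => w _ do rewrite EFinM.
rewrite ge0_integralZl //; first exact: mPhi'.
  by move=> w _; rewrite lee_fin.
by rewrite lee_fin.
Qed.

Lemma integral_ring_sets_cst J (G : seq {set K} -> R) : (forall l, 0 <= G l) ->
  (\int[P]_w (G (ring_sets N h J w))%:E = (expect p J G)%:E)%E.
Proof.
move=> G0; rewrite (@integral_ring_sets J (fun l _ => G l)) //.
by rewrite integral_cst // [X in (_ * X)%E](_ : _ = 1%E) ?mule1 //; exact: probability_setT.
Qed.

Hypothesis n3 : (3 <= n)%N.

(** Write y - a as a combination of indicators and apply [sqr_sum_le] under the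
    expectation. *)
Lemma expect_linear_le J (L : seq {set K} -> (K -> R) -> R) (c : R) (y : K -> R) (a : R) :
  (forall l (z : K -> R) x, L l (fun k => \sum_i z i * x i k) = \sum_i z i * L l (x i)) ->
  (forall l x e, L l (fun k => x k + e) = L l x) ->
  (forall k, expect p J (fun l => L l (delta k) ^+ 2) <= c) ->
  expect p J (fun l => L l y ^+ 2) <= c * (\sum_i `|y i - a|) ^+ 2.
Proof.
move=> Llin Lshift Lc; have hp := rate_bounds h0.
have Ly l : L l y = \sum_i (y i - a) * L l (delta i).
  rewrite -Llin -[RHS](Lshift l _ a); congr (L l _); apply/funext => k.
  rewrite (eq_bigr (fun i => (y i - a) * (i == k)%:R)) ?sum_single ?subrK // => i _.
  by rewrite /delta eq_sym.
pose Z := \sum_i `|y i - a|.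
apply: (@le_trans _ _ (expect p J (fun l => Z * \sum_i `|y i - a| * L l (delta i) ^+ 2))).
  by apply: le_expect => // l; rewrite Ly; exact: sqr_sum_le.
rewrite expectZ expect_sum mulrC expr2 mulrA -/Z; apply: ler_wpM2r.
  by apply: sumr_ge0.
rewrite mulr_sumr; apply: ler_sum => i _; rewrite expectZ mulrC.
exact: ler_wpM2r.
Qed.

(** The factor M ^ 2 turns the sum of deviations into their mean. *)
Lemma integral_linear_le J (L : seq {set K} -> (K -> R) -> R) (c : R) (a : Om -> R) :
  0 <= c ->
  (forall l (z : K -> R) x, L l (fun k => \sum_i z i * x i k) = \sum_i z i * L l (x i)) ->
  (forall l x e, L l (fun k => x k + e) = L l x) ->
  (forall k, expect p J (fun l => L l (delta k) ^+ 2) <= c) ->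
  (\int[P]_w (L (ring_sets N h J w) (fun k => Y k 0 w) ^+ 2)%:E <=
   (c * (n ^ d)%:R ^+ 2)%:E *
   \int[P]_w (((n ^ d)%:R^-1 * \sum_i `|Y i 0 w - a w|) ^+ 2)%:E)%E.
Proof.
move=> c0 Llin Lshift Lc.
have LY l w : L l (fun k => Y k 0 w) = \sum_i Y i 0 w * L l (delta i).
  rewrite -Llin; congr (L l _); apply/funext => k.
  rewrite (eq_bigr (fun i => Y i 0 w * (i == k)%:R)) ?sum_single // => i _.
  by rewrite /delta eq_sym.
have mL l : measurable_fun (setT : set (g_sigma_algebraType initial_sigma))
    (fun w => L l (fun k => Y k 0 w) ^+ 2).
  rewrite (_ : (fun w => _) = (fun w => (\sum_i Y i 0 w * L l (delta i)) ^+ 2)); last first.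
    by apply/funext => w; rewrite LY.
  apply: measurable_funX; apply: measurable_sum => i; apply: measurable_funM => //.
  by move=> _ U mU; apply: sub_gen_smallest; exists i => //; exists U.
rewrite (@integral_ring_sets J (fun l w => L l (fun k => Y k 0 w) ^+ 2)) //; last first.
  by move=> l w; exact: sqr_ge0.
apply: le_integral_scale.
- by rewrite mulr_ge0 // sqr_ge0.
- rewrite (_ : (fun w => _) = (fun w => \sum_(s : J.-tuple {set K})
     (\prod_(S <- s) weight p S) * L s (fun k => Y k 0 w) ^+ 2)); last first.
    by apply/funext => w; rewrite expect_tuple.
  apply: measurable_sum => s; apply: measurable_funM => //.
  apply: measurable_fun_generated (mL s); exact: initial_sigma_measurable.
- move=> w; rewrite -[leLHS](expect_cst (d:=d) (n:=n) p J 0); apply: le_expect.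
    exact: rate_bounds.
  by move=> l; exact: sqr_ge0.
- by move=> w; exact: sqr_ge0.
move=> w; apply: le_trans (expect_linear_le _ (a w) Llin Lshift Lc) _.
rewrite -[leRHS]mulrA -exprMn mulVKf //.
by rewrite pnatr_eq0 expn_eq0; case: n n3.
Qed.

End integral_ring_sets.

(** * The process started from the indicator of the origin *)

Section construction.
Context {R : realType} {dsp : measure_display} {Om : measurableType dsp}.
Context {P : probability Om R} {d n : nat}.
Local Notation K := (torus d n).
Variables (N : K -> R -> {RV P >-> nat}) (Y : K -> R -> {RV P >-> R}).
Hypothesis proc : smoothing_process N Y.
Hypothesis d1 : (1 <= d)%N.
Hypothesis n3 : (3 <= n)%N.

Lemma ae_counting_paths : {ae P, forall w, forall k, counting_path (clock_paths N w k)}.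
Proof. by apply: filter_forall => k; exact: (poisson_paths (smoothing_clocks proc k)). Qed.

(** One mesh works for all the grid times up to T. *)
Lemma chain_ring_sets w (y : K -> R -> R) t T :
  (forall k, counting_path (clock_paths N w k)) -> smoothing_path (clock_paths N w) y ->
  0 < t -> 0 <= T ->
  \forall m \near \oo, forall J, J%:R * (t / m.+1%:R) <= T ->
    chain (ring_sets N (t / m.+1%:R) J w) (fun k => y k 0) =
    (fun k => y k (J%:R * (t / m.+1%:R))).
Proof.
move=> cw hy t0 T0; have [e e0 he] := smoothing_grid cw hy T0.
exists (Num.truncn (t / e)) => // m /= hm J JT.
have h0 : 0 < t / m.+1%:R by rewrite divr_gt0 // ltr0n.
have hme : t / m.+1%:R < e.
  rewrite ltr_pdivrMr ?ltr0n // mulrC -ltr_pdivrMr //.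
  by apply: lt_le_trans (truncnS_gt _) _; rewrite ler_nat ltnS.
have uS j : j.+1%:R * (t / m.+1%:R) - j%:R * (t / m.+1%:R) = t / m.+1%:R.
  by rewrite -natr1; ring.
have := he (fun j => j%:R * (t / m.+1%:R)) J; rewrite mul0r => -> //.
  by move=> j; rewrite -subr_gt0 uS.
by move=> j; rewrite uS.
Qed.

Definition grid_value (i : K) (t : R) (m : nat) (w : Om) : R :=
  chain (ring_sets N (t / m.+1%:R) m.+1 w) (delta 0) i.

Lemma grid_value_bounds i t m w : 0 <= grid_value i t m w <= 1.
Proof. by apply: chain_bounds => // j; exact: delta_bounds. Qed.

Lemma measurable_grid_value i t m : measurable_fun setT (grid_value i t m).
Proof.
exact: (@measurable_ring_sets_fun _ _ _ P _ _ N _ _ (fun l _ => chain l (delta 0) i)).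
Qed.

(** An upper limit, so that measurability holds everywhere while convergence is
    only known on almost every path. *)
Definition delta_value (i : K) (t : R) (w : Om) : R := limn_sup (fun m => grid_value i t m w).

Lemma measurable_delta_value i t : measurable_fun setT (delta_value i t).
Proof.
apply: (@measurable_fun_limn_sup _ _ _ _ (fun m w => grid_value i t m w)) => [w _|w _|m].
- by exists 1 => _ [m _ <-]; case/andP: (grid_value_bounds i t m w).
- by exists 0 => _ [m _ <-]; case/andP: (grid_value_bounds i t m w).
- exact: measurable_grid_value.
Qed.

Definition delta_process (i : K) (t : R) : {RV P >-> R} :=
  mfun_Sub (mem_set (measurable_delta_value i t)).

Lemma delta_process0 j w : delta_process j 0 w = (j == 0)%:R.
Proof.
change (delta_value j 0 w = delta 0 j).
rewrite /delta_value (_ : (fun m => _) = (fun=> delta 0 j)).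
  have [_ ->] := cvg_limn_inf_sup (cvg_cst (delta 0 j : R) (F := \oo)) => //.
apply/funext => m; rewrite /grid_value /ring_sets mul0r.
elim: (iota 0 m.+1) => [//|a l IH]; rewrite /chain /= (_ : update _ _ = delta 0) //.
apply/funext => k; rewrite /update ifN // inE !mulr0 subnn //.
Qed.

Lemma grid_value_cvg w (y : K -> R -> R) t i :
  (forall k, counting_path (clock_paths N w k)) -> smoothing_path (clock_paths N w) y ->
  (forall k, y k 0 = delta 0 k) -> 0 < t -> grid_value i t m w @[m --> \oo] --> y i t.
Proof.
move=> cw hy hy0 t0; apply: cvg_near_cst.
have := chain_ring_sets cw hy t0 (ltW t0); apply: filterS => m hm.
have E : m.+1%:R * (t / m.+1%:R) = t by rewrite mulrC divfK // pnatr_eq0.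
have := hm m.+1; rewrite E lexx => /(_ isT) /(congr1 (fun x => x i)) /= <-.
by rewrite /grid_value; congr (chain _ _ i); apply/funext => k; rewrite hy0.
Qed.

Lemma delta_value_solution w i t :
  (forall k, counting_path (clock_paths N w k)) -> 0 <= t ->
  delta_value i t w = solution (clock_paths N w) (delta 0) i t.
Proof.
move=> cw; rewrite le_eqVlt => /orP[/eqP <-|t0].
  by rewrite (solution0 cw); exact: delta_process0.
have := @grid_value_cvg w _ t i cw (solution_smoothing cw (delta 0)) (solution0 cw (delta 0)) t0.
by move=> /cvg_limn_inf_sup[_]; rewrite /delta_value => ->.
Qed.

(** The initial configuration is deterministic, so its sigma-algebra is trivial
    and independence is inherited from the given process. *)
Lemma delta_process_smoothing : smoothing_process N delta_process.
Proof.
split.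
- exact: smoothing_clocks proc.
- have sub o A : driving_sigma N delta_process o A -> driving_sigma N Y o A.
    case: o => [k//|]; rewrite /= /sigma_rvs.
    apply: smallest_sub; first exact: smallest_sigma_algebra.
    move=> _ [i _ [U mU <-]]; set B := _ `&` _.
    have EB w : B w <-> U (i == 0)%:R.
      by rewrite -(delta_process0 i w); split => [[]|].
    have [h|h] := pselect (U (i == 0)%:R).
      rewrite (_ : B = setT); first exact: (@measurableT _ (g_sigma_algebraType _)).
      by apply/seteqP; split => // w _; exact/EB.
    rewrite (_ : B = set0); first exact: (@measurable0 _ (g_sigma_algebraType _)).
    by apply/seteqP; split => // w /EB.
  by move=> J A hA; apply: (smoothing_indep proc) => o oJ; apply: sub; exact: hA.
- apply: filterS ae_counting_paths => w cw.
  have [s1 s2] := solution_smoothing cw (delta 0).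
  have E i t : 0 <= t -> delta_process i t w = solution (clock_paths N w) (delta 0) i t.
    by move=> t0; exact: delta_value_solution.
  split=> [k s t s0 st hr|k t rt].
    by rewrite !E ?(le_trans s0 st) //; exact: s1.
  have t0 : 0 < t by case: rt.
  rewrite E ?(ltW t0) // s2 //; congr (_ * _); apply: eq_bigr => j _.
  congr (lim _); have eq_E : {near t^'-, (fun s => delta_process j s w) =1
      (fun s => solution (clock_paths N w) (delta 0) j s)}.
    near=> s; apply: E; apply: ltW; near: s; exact: nbhs_left_gt.
  apply/seteqP; split; apply: near_eq_cvg => //.
  by apply: filterS eq_E => s ->.
Unshelve. all: by end_near. Qed.
End construction.

(** * Bounds for the mean at two times *)

Section mean_convergence.
Context {R : realType} {d n : nat}.
Local Notation K := (torus d n).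

(** If the values are within e of their mean at time s, the maximum principle
    keeps them, and hence the mean, in the same interval forever: the mean is
    Cauchy. *)
Lemma mean_cvg (f : K -> R -> nat) (y : K -> R -> R) : (1 <= d)%N -> (3 <= n)%N ->
  (forall k, counting_path (f k)) -> smoothing_path f y ->
  (forall e : R, 0 < e -> exists2 s, 0 <= s &
     \sum_i (y i s - torus_mean (fun k => y k s)) ^+ 2 < e) ->
  cvg (torus_mean (fun k => y k t) @[t --> +oo]).
Proof.
move=> d1 n3 cf hy hs; apply/cauchy_cvgP/cauchy_exP => e e0.
(* Half of e leaves room for the strict inequality of the ball. *)
have [|s s0 hse] := hs ((e / 2) ^+ 2); first by rewrite exprn_gt0 // divr_gt0.
set m := torus_mean (fun k => y k s) in hse.
exists m; suff : \forall t \near +oo, ball m e (torus_mean (fun k => y k t)) by [].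
near=> t.
have st : s <= t by near: t; apply: nbhs_pinfty_ge; exact: num_real.
have hsi i : m - e / 2 <= y i s <= m + e / 2.
  rewrite -ler_distl -ler_sqr ?nnegrE // ?divr_ge0 // ?(ltW e0) // real_normK ?num_real //.
  apply: le_trans (ltW hse); rewrite (bigD1 i) //= lerDl sumr_ge0 // => j _.
  exact: sqr_ge0.
have ht := smoothing_max_principle cf d1 n3 hy s0 st hsi.
have := torus_mean_bounds n3 ht; rewrite /ball /= distrC => /andP[h1 h2].
by rewrite ltr_distl; apply/andP; split; lra.
Unshelve. all: by end_near. Qed.

End mean_convergence.

Section bounds.
Context {R : realType} {dsp : measure_display} {Om : measurableType dsp}.
Context {P : probability Om R} {d n : nat}.
Local Notation K := (torus d n).
Variables (N : K -> R -> {RV P >-> nat}) (Y : K -> R -> {RV P >-> R}).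
Hypothesis proc : smoothing_process N Y.
Hypothesis d1 : (1 <= d)%N.
Hypothesis n3 : (3 <= n)%N.

Let h (t : R) (m : nat) : R := t / m.+1%:R.
Let p (t : R) (m : nat) : R := 1 - expR (- h t m).

Let h_gt0 t m : 0 < t -> 0 < h t m.
Proof. by move=> t0; rewrite divr_gt0 // ltr0n. Qed.

Lemma measurable_torus_mean (X : K -> Om -> R) :
  (forall i, measurable_fun setT (X i)) ->
  measurable_fun setT (fun w => torus_mean (X ^~ w)).
Proof. by move=> mX; apply: measurable_funM => //; exact: measurable_sum. Qed.

Lemma measurable_energy (X : K -> Om -> R) :
  (forall i, measurable_fun setT (X i)) ->
  measurable_fun setT (fun w => energy (X ^~ w)).
Proof.
move=> mX; apply: measurable_funM => //; apply: measurable_sum => i.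
under eq_fun => w do rewrite big_mkcond /=.
apply: measurable_sum => j; case: (neighbor i j) => //.
by apply: measurable_funX; exact: measurable_funB.
Qed.

Lemma measurable_empirical_variance (X : K -> Om -> R) :
  (forall i, measurable_fun setT (X i)) ->
  measurable_fun setT (fun w => empirical_variance (X ^~ w)).
Proof.
move=> mX; apply: measurable_funM => //; apply: measurable_sum => i.
by apply: measurable_funX; apply: measurable_funB => //; exact: measurable_torus_mean.
Qed.

(** Dominated convergence along the grids; G needs no continuity because the
    grid chain is eventually equal to its limit. *)
Lemma expect_cvg (G : (K -> R) -> R) (B t : R) :
  (forall x, 0 <= G x) -> (forall x, (forall i, 0 <= x i <= 1) -> G x <= B) ->
  (forall X : K -> Om -> R, (forall i, measurable_fun setT (X i)) ->
    measurable_fun setT (fun w => G (X ^~ w))) ->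
  0 < t ->
  expect (p t m) m.+1 (fun l => G (chain l (delta 0))) @[m --> \oo] -->
    fine (\int[P]_w (G (fun i => delta_process N d1 n3 i t w))%:E)%E /\
  (\int[P]_w (G (fun i => delta_process N d1 n3 i t w))%:E \is a fin_num)%E.
Proof.
move=> G0 GB mG t0; set V := (\int[P]_w _)%E.
have hp m : 0 <= p t m <= 1 by apply: rate_bounds; exact: h_gt0.
have mf : forall m, measurable_fun setT (fun w => (G (fun i => grid_value N i t m w))%:E).
  by move=> m; apply/measurable_EFinP/mG => i; exact: measurable_grid_value.
have mV : measurable_fun setT (fun w => (G (fun i => delta_process N d1 n3 i t w))%:E).
  by apply/measurable_EFinP/mG => i; exact: measurable_funPT.
have cv : {ae P, forall w, setT w -> (G (fun i => grid_value N i t m w))%:E @[m --> \oo] -->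
    (G (fun i => delta_process N d1 n3 i t w))%:E}.
  apply: filterS (ae_counting_paths proc) => w cw _; apply: cvg_near_cst.
  have hy := solution_smoothing cw (delta 0).
  have := chain_ring_sets cw hy t0 (ltW t0).
  apply: filterS => m hm; congr (G _)%:E; apply/funext => i.
  have E : m.+1%:R * (t / m.+1%:R) = t by rewrite mulrC divfK // pnatr_eq0.
  have := hm m.+1; rewrite E lexx => /(_ isT) /(congr1 (fun x => x i)) /= e.
  transitivity (solution (clock_paths N w) (delta 0) i t); last first.
    exact/esym/(delta_value_solution d1 n3 i cw (ltW t0)).
  rewrite -e /grid_value; congr (chain _ _ i).
  by apply/funext => k; rewrite (solution0 cw).
have [] := @dominated_convergence _ _ _ P setT measurableT _ _ (cst B%:E) mf mV cv.
- exact: (finite_measure_integrable_cst P B).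
- apply: aeW => w m _ /=; rewrite lee_fin ger0_norm //.
  by apply: GB => i; exact: grid_value_bounds.
move=> iV _; rewrite -/V.
have fV : V \is a fin_num by exact: integrable_fin_num.
rewrite -(fineK fV) => /fine_cvgP[_ h1]; split => //.
apply: cvg_trans h1; apply: near_eq_cvg; apply: nearW => m /=.
by rewrite -[RHS]/(fine (expect (p t m) m.+1 (fun l => G (chain l (delta 0))))%:E)
  -(integral_ring_sets_cst proc (h_gt0 m t0)).
Qed.

Variable a : Om -> R.
Let I := (\int[P]_w (((n ^ d)%:R^-1 * \sum_i `|Y i 0 w - a w|) ^+ 2)%:E)%E.
Hypothesis Ify : (I < +oo)%E.

Let I0 : (0 <= I)%E. Proof. by apply: integral_ge0 => w _; rewrite lee_fin sqr_ge0. Qed.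
Let Ifin : (I \is a fin_num)%E. Proof. by rewrite ge0_fin_numE. Qed.

(** Transfers a bound for linear functionals of grid chains started from
    indicators to the process itself.  The functional may depend on the mesh,
    so that it can look at the chain at an intermediate time. *)
Lemma functional_bound (t : R) (q : nat) (L : nat -> seq {set K} -> (K -> R) -> R)
    (Z : Om -> R) (e_ : nat -> R) (e : R) :
  0 < t -> (forall m, 0 <= e_ m) -> e_ m @[m --> \oo] --> e ->
  (forall m l (z : K -> R) x,
    L m l (fun k => \sum_i z i * x i k) = \sum_i z i * L m l (x i)) ->
  (forall m l x b, L m l (fun k => x k + b) = L m l x) ->
  (forall m k, expect (p t m) (q * m.+1) (fun l => L m l (delta k) ^+ 2) <= e_ m) ->
  (forall w, (forall k, counting_path (clock_paths N w k)) ->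
     smoothing_path (clock_paths N w) (fun k s => Y k s w) ->
     \forall m \near \oo,
       L m (ring_sets N (h t m) (q * m.+1) w) (fun k => Y k 0 w) = Z w) ->
  (\int[P]_w (Z w ^+ 2)%:E <= (e * (n ^ d)%:R ^+ 2)%:E * I)%E.
Proof.
move=> t0 e_0 cve Llin Lshift Le LZ.
apply: (@fatou_ae _ _ _ P
  (fun m w => L m (ring_sets N (h t m) (q * m.+1) w) (fun k => Y k 0 w) ^+ 2) _
  (fun m => ((e_ m * (n ^ d)%:R ^+ 2)%:E * I)%E)).
- move=> m; apply: (@measurable_ring_sets_fun _ _ _ P _ _ N (h t m) (q * m.+1)
    (fun l w => L m l (fun k => Y k 0 w) ^+ 2)) => l.
  have Ll w : L m l (fun k => Y k 0 w) = \sum_i Y i 0 w * L m l (delta i).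
    rewrite -Llin; congr (L m l _); apply/funext => k.
    rewrite (eq_bigr (fun i => Y i 0 w * (i == k)%:R)) ?sum_single // => i _.
    by rewrite /delta eq_sym.
  under eq_fun => w do rewrite Ll.
  by apply: measurable_funX; apply: measurable_sum => i; exact: measurable_funM.
- by move=> m w; exact: sqr_ge0.
- by move=> w; exact: sqr_ge0.
- have := smoothing_paths proc; apply: filterS2 (ae_counting_paths proc) => w cw hw.
  by apply: cvg_near_cst; apply: filterS (LZ w cw hw) => m ->.
- move=> m; apply: (integral_linear_le proc (h_gt0 m t0) n3 (L := L m) a) => // k.
  exact: Le.
- rewrite -(fineK Ifin) -EFinM; under eq_fun => m do rewrite -EFinM.
  apply: cvg_EFin; first exact: nearW.
  exact: cvgM (cvgM cve (cvg_cst _)) (cvg_cst _).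
Qed.

Lemma take_ring_sets hh J1 J2 w : take J1 (ring_sets N hh (J1 + J2) w) = ring_sets N hh J1 w.
Proof. by rewrite /ring_sets iotaD map_cat take_size_cat // size_map size_iota. Qed.

Lemma rate_le (s : R) : 1 - expR (- s) <= s.
Proof. by rewrite lerBlDr -lerBlDl expR_ge1Dx. Qed.

(** The grid has m + 1 intervals in [0, t] and r (m + 1) after it.  The error r
    (m + 1) p ^ 2, with p at most t / (m + 1), is of order 1 / (m + 1). *)
Lemma mean_increment_bound (t : R) (r : nat) : 0 < t ->
  (\int[P]_w ((mean_at Y (r.+1%:R * t) w - mean_at Y t w) ^+ 2)%:E <=
  ((n ^ d)%:R * fine (\int[P]_w (energy (fun i => delta_process N d1 n3 i t w))%:E))%:E * I)%E.
Proof.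
move=> t0; set V := fine _.
have M0 : (n ^ d)%:R != 0 :> R by rewrite pnatr_eq0 expn_eq0; case: n n3.
have [cV _] : expect (p t m) m.+1 (fun l => energy (chain l (delta 0))) @[m --> \oo] --> V /\ _ :=
  expect_cvg (@energy_ge0 R d n) (@energy_le R d n) measurable_energy t0.
have -> : (n ^ d)%:R * V = ((n ^ d)%:R^-1 * V + 0) * (n ^ d)%:R ^+ 2.
  by rewrite addr0 expr2 mulrACA mulVf // mul1r mulrC.
pose C : R := #|{set K}|%:R * lyapunov_bound (R := R) (d := d) (n := n).
have C0 : 0 <= C.
  rewrite mulr_ge0 // /lyapunov_bound addr_ge0 // mulr_ge0 ?invr_ge0 //.
  apply: le_trans (energy_ge0 (fun=> 0)) _.
  by apply: energy_le => i; rewrite lexx ler01.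
apply: (@functional_bound t r.+1
  (fun m l x => torus_mean (chain l x) - torus_mean (chain (take m.+1 l) x)) _
  (fun m => (n ^ d)%:R^-1 * expect (p t m) m.+1 (fun l => energy (chain l (delta 0))) +
    (r%:R * C * t ^+ 2) * harmonic m)) => //.
- move=> m; rewrite addr_ge0 //.
    rewrite mulr_ge0 ?invr_ge0 // -(expect_cst (d:=d) (n:=n) (p t m) m.+1 0).
    by apply: le_expect; [exact: rate_bounds (h_gt0 m t0)|move=> l; exact: energy_ge0].
  apply: mulr_ge0; last by rewrite /harmonic /= invr_ge0 ler0n.
  exact: mulr_ge0 (mulr_ge0 (ler0n _ _) C0) (sqr_ge0 _).
- apply: cvgD; first exact: cvgM (cvg_cst _) cV.
  by rewrite -[X in _ --> X](mulr0 (r%:R * C * t ^+ 2)); apply: cvgM; [exact: cvg_cst|exact: cvg_harmonic].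
- by move=> m l z x; rewrite !chain_lin !torus_mean_lin -sumrB; apply: eq_bigr => i _; rewrite mulrBr.
- by move=> m l x b; rewrite !(chain_add_cst d1 n3) !(torus_mean_add_cst n3) opprD addrACA subrr addr0.
- move=> m k; rewrite mulSn.
  have hp := rate_bounds (h_gt0 m t0).
  apply: le_trans (mean_increment_expect d1 n3 m.+1 (r * m.+1) hp _) _.
    by move=> j; exact: delta_bounds.
  apply: lerD.
    by rewrite -(translate_delta k) (expect_translate _ _ _ (energy_translate d1 n3 (- k))).
  rewrite -/C natrM.
  have hpl : p t m ^+ 2 <= h t m ^+ 2.
    by rewrite ler_sqr ?nnegrE ?(ltW (h_gt0 m t0)) //; [exact: rate_le|case/andP: hp].
  have -> : r%:R * C * t ^+ 2 * harmonic m = r%:R * m.+1%:R * (C * h t m ^+ 2).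
    rewrite /harmonic /h /=; field.
    by rewrite ?[1 + _]addrC natr1 pnatr_eq0.
  by rewrite ler_wpM2l ?mulr_ge0 // ler_wpM2l.
- move=> w cw hw.
  have hT : 0 <= r.+1%:R * t by rewrite mulr_ge0 // ltW.
  have := chain_ring_sets cw hw t0 hT; apply: filterS => m hm; rewrite mulSn take_ring_sets /mean_at.
  have E q : (q * m.+1)%:R * (t / m.+1%:R) = q%:R * t.
    by rewrite natrM -mulrA [_ * (t / _)]mulrC divfK // pnatr_eq0.
  have E1 : m.+1%:R * (t / m.+1%:R) = t by rewrite mulrC divfK // pnatr_eq0.
  by rewrite -mulSn !hm ?E ?E1 // ler_peMl ?ler1n // ltW.
Qed.

(** A squared deviation at one site is at most M times the variance. *)
Lemma deviation_bound (t : R) (i : K) : 0 < t ->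
  (\int[P]_w ((Y i t w - mean_at Y t w) ^+ 2)%:E <=
  ((n ^ d)%:R ^+ 3 * fine (\int[P]_w (empirical_variance (fun i => delta_process N d1 n3 i t w))%:E))%:E * I)%E.
Proof.
move=> t0; set V := fine _.
have M0 : (n ^ d)%:R != 0 :> R by rewrite pnatr_eq0 expn_eq0; case: n n3.
have [cV _] : expect (p t m) m.+1 (fun l => empirical_variance (chain l (delta 0))) @[m --> \oo] --> V /\ _ :=
  expect_cvg empirical_variance_ge0 (empirical_variance_le1 n3) measurable_empirical_variance t0.
rewrite [in leRHS]exprS mulrAC.
apply: (@functional_bound t 1%N
  (fun m l x => chain l x i - torus_mean (chain l x)) _
  (fun m => (n ^ d)%:R * expect (p t m) m.+1 (fun l => empirical_variance (chain l (delta 0))))) => //.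
- move=> m; rewrite mulr_ge0 // -(expect_cst (d:=d) (n:=n) (p t m) m.+1 0).
  by apply: le_expect; [exact: rate_bounds (h_gt0 m t0)|move=> l; exact: empirical_variance_ge0].
- exact: cvgM (cvg_cst _) cV.
- by move=> m l z x; rewrite !chain_lin !torus_mean_lin -sumrB; apply: eq_bigr => j _; rewrite mulrBr.
- by move=> m l x b; rewrite !(chain_add_cst d1 n3) !(torus_mean_add_cst n3) opprD addrACA subrr addr0.
- move=> m k; rewrite mul1n -expectZ.
  rewrite -(@expect_translate R d n (p t m) m.+1 (- k) (fun x => (n ^ d)%:R * empirical_variance x)); last first.
    by move=> x; rewrite empirical_variance_translate.
  rewrite translate_delta; apply: le_expect; first exact: rate_bounds (h_gt0 m t0).
  move=> l; rewrite /empirical_variance mulVKf // (bigD1 i) //= lerDl sumr_ge0 // => j _.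
  exact: sqr_ge0.
- move=> w cw hw; have := chain_ring_sets cw hw t0 (ltW t0); apply: filterS => m hm.
  have E : m.+1%:R * (t / m.+1%:R) = t by rewrite mulrC divfK // pnatr_eq0.
  by rewrite mul1n hm E.
Qed.

End bounds.

(** * Positivity of the decay rate *)

(** Mean value theorem, with the cosine above 1/2 near 0. *)
Lemma sin_ge_half (R : realType) : exists2 e : R, 0 < e &
  forall x, 0 < x -> x < e -> x / 2 <= sin x.
Proof.
have : \forall x \near (0 : R), 1 / 2 < cos x.
  have := @continuous_cos R 0; move=> /cvgrPdist_lt /(_ (1 / 2)).
  rewrite cos0 divr_gt0 // => /(_ isT); apply: filterS => x.
  by rewrite ltr_distlC => /andP[h _]; lra.
case=> e /= e0 he; exists e => // x x0 xe.
have dsin (z : R) : is_derive z 1 sin (cos z) by exact: is_derive_sin.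
have [|c cx] := @MVT R (@sin R) (@cos R) 0 x x0 (fun z _ => dsin z).
  by apply: continuous_subspaceT => z; exact: continuous_sin.
rewrite sin0 !subr0 => ->.
move: cx; rewrite in_itv /= => /andP[c0 cx].
have : 1 / 2 < cos c.
  by apply: he; rewrite /= sub0r normrN gtr0_norm // (lt_trans cx).
nra.
Qed.

(** Half-angle formula: the gap is 2 sin(pi / n) ^ 2, and pi is at least 2. *)
Lemma gap_lower_bound (R : realType) : exists n2 : nat, forall n, (n2 <= n)%N ->
  (0 < n)%N -> 2 / n%:R ^+ 2 <= gap R n.
Proof.
have [e e0 he] := sin_ge_half R.
exists (Num.truncn (pi / e)).+1 => n hn n0.
have n0' : 0 < n%:R :> R by rewrite ltr0n.
have xe : pi / n%:R < e.
  rewrite ltr_pdivrMr // mulrC -ltr_pdivrMr //.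
  by apply: lt_le_trans (truncnS_gt _) _; rewrite ler_nat.
have x0 : 0 < pi / n%:R :> R by rewrite divr_gt0 // pi_gt0.
have := he _ x0 xe.
have -> : gap R n = 2 * sin (pi / n%:R) ^+ 2.
  rewrite /gap (_ : 2 * pi / n%:R = (pi / n%:R) *+ 2); last by rewrite -mulrA mulr_natl.
  by rewrite cos_mulr2n cos2sin2; ring.
have hpi : n%:R^-1 <= pi / n%:R / 2 :> R.
  by rewrite mulrAC -[leLHS]mul1r ler_pM2r ?invr_gt0 // ler_pdivlMr // mul1r pi_ge2.
move=> hs; have h2 : n%:R^-1 <= sin (pi / n%:R) :> R by exact: le_trans hpi hs.
rewrite -exprVn ler_pM2l // ler_sqr ?nnegrE ?invr_ge0 ?(le_trans _ h2) ?invr_ge0 //.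
Qed.

Lemma rate_eventually_gt0 (R : realType) (d : nat) (a3 : R) : (1 <= d)%N ->
  exists n2 : nat, forall n, (n2 <= n)%N -> (0 < n)%N ->
  0 < 2 * gap R n / d%:R - a3 / (n ^ (d + 4))%:R.
Proof.
move=> d1; have [n2 hn2] := gap_lower_bound R.
exists (maxn n2 (Num.truncn (a3 * d%:R)).+1) => n; rewrite geq_max => /andP[h1 h2] n0.
have n0' : 0 < n%:R :> R by rewrite ltr0n.
have d0 : 0 < d%:R :> R by rewrite ltr0n.
rewrite subr_gt0; apply: (@lt_le_trans _ _ (2 * (2 / n%:R ^+ 2) / d%:R)); last first.
  by rewrite ler_pM2r ?invr_gt0 // ler_pM2l //; exact: hn2.
(* n ^ (d + 4) is at least n times n ^ 2, so n > a3 d suffices. *)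
have ha : a3 * d%:R < n%:R.
  by apply: lt_le_trans (truncnS_gt _) _; rewrite ler_nat.
have hn : n%:R <= (n ^ (d + 2))%:R :> R.
  by rewrite ler_nat -{1}(expn1 n) leq_pexp2l // addn2.
rewrite (_ : (n ^ (d + 4))%:R = (n ^ (d + 2))%:R * n%:R ^+ 2 :> R); last first.
  by rewrite -natrX -natrM -expnD -addnA.
rewrite ltr_pdivrMr; last by rewrite mulr_gt0 ?exprn_gt0 // (lt_le_trans n0').
have -> : 2 * (2 / n%:R ^+ 2) / d%:R * ((n ^ (d + 2))%:R * n%:R ^+ 2) =
  4 * (n ^ (d + 2))%:R / d%:R :> R.
  by field; rewrite !gt_eqF.
rewrite ltr_pdivlMr //; nra.
Qed.

(** * The limit of the mean *)

Section limit.
Context {R : realType} {dsp : measure_display} {Om : measurableType dsp}.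
Context {P : probability Om R} {d n : nat}.
Local Notation K := (torus d n).
Variables (N : K -> R -> {RV P >-> nat}) (Y : K -> R -> {RV P >-> R}).
Hypothesis proc : smoothing_process N Y.
Hypothesis d1 : (1 <= d)%N.
Hypothesis n3 : (3 <= n)%N.
Variable a : Om -> R.
Let I := (\int[P]_w (((n ^ d)%:R^-1 * \sum_i `|Y i 0 w - a w|) ^+ 2)%:E)%E.
Hypothesis Ify : (I < +oo)%E.

(** The expected sum of squared deviations tends to 0 along multiples of t, so
    on almost every path it gets arbitrarily small, which is what [mean_cvg]
    asks for. *)
Lemma ae_mean_cvg (t : R) : 0 < t ->
  fine (\int[P]_w (empirical_variance (fun i => delta_process N d1 n3 i (r.+1%:R * t) w))%:E)%E
    @[r --> \oo] --> 0 ->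
  {ae P, forall w, cvg (mean_at Y s w @[s --> +oo])}.
Proof.
move=> t0 HV; set V := fun r : nat => fine _ in HV.
have I0 : (0 <= I)%E by apply: integral_ge0 => w _; rewrite lee_fin sqr_ge0.
have Ifin : (I \is a fin_num)%E by rewrite ge0_fin_numE.
pose Z (r : nat) w := \sum_i (Y i (r.+1%:R * t) w - mean_at Y (r.+1%:R * t) w) ^+ 2.
have rt0 r : 0 < r.+1%:R * t by rewrite mulr_gt0 // ltr0n.
have mdev s i : measurable_fun setT (fun w => (Y i s w - mean_at Y s w) ^+ 2).
  apply: measurable_funX; apply: measurable_funB => //.
  by apply: (@measurable_torus_mean _ _ _ _ _ (fun i w => Y i s w)) => j.
have mZ r : measurable_fun setT (Z r) by apply: measurable_sum => i; exact: mdev.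
have Z0 r w : 0 <= Z r w by apply: sumr_ge0 => i _; exact: sqr_ge0.
have iZ r : (\int[P]_w (Z r w)%:E <= (#|K|%:R * ((n ^ d)%:R ^+ 3 * V r) * fine I)%:E)%E.
  under eq_integral => w _ do rewrite -sumEFin.
  rewrite ge0_integral_sum //; last 2 first.
  - by move=> i; apply/measurable_EFinP; exact: mdev.
  - by move=> i w _; rewrite lee_fin sqr_ge0.
  apply: (@le_trans _ _ (\sum_(i : K) ((n ^ d)%:R ^+ 3 * V r * fine I)%:E)%E).
    apply: lee_sum => i _; rewrite EFinM (fineK Ifin).
    exact: (deviation_bound proc d1 n3 Ify i (rt0 r)).
  by rewrite sumEFin lee_fin big_const iter_addr_0 -[leLHS]mulr_natl mulrA.
have cZ : (\int[P]_w (Z r w)%:E @[r --> \oo] --> 0)%E.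
  apply: (@squeeze_cvge _ _ _ _ (cst 0%E) _ (fun r => (#|K|%:R * ((n ^ d)%:R ^+ 3 * V r) * fine I)%:E)).
  - apply: nearW => r; rewrite iZ andbT; apply: integral_ge0 => w _; by rewrite lee_fin.
  - exact: cvg_cst.
  - apply: cvg_EFin; first exact: nearW.
    have -> : 0 = #|K|%:R * ((n ^ d)%:R ^+ 3 * 0) * fine I :> R by rewrite !mulr0 mul0r.
    exact: cvgM (cvgM (cvg_cst _) (cvgM (cvg_cst _) HV)) (cvg_cst _).
have small := ae_small_of_integral mZ Z0 cZ.
have good : {ae P, forall w, (forall k, counting_path (clock_paths N w k)) /\
    smoothing_path (clock_paths N w) (fun k s => Y k s w)}.
  by have := smoothing_paths proc; apply: filterS2 (ae_counting_paths proc) => w.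
apply: filterS2 small good => w hs [cw hw].
apply: (mean_cvg d1 n3 cw hw) => e e0; have [r hr] := hs e e0.
by exists (r.+1%:R * t); [exact: ltW|exact: hr].
Qed.

Lemma mean_limit_bound (t : R) : 0 < t ->
  fine (\int[P]_w (empirical_variance (fun i => delta_process N d1 n3 i (r.+1%:R * t) w))%:E)%E
    @[r --> \oo] --> 0 ->
  (\int[P]_w ((mean_at Y t w - mean_limit Y w) ^+ 2)%:E <=
  ((n ^ d)%:R * fine (\int[P]_w (energy (fun i => delta_process N d1 n3 i t w))%:E))%:E * I)%E.
Proof.
move=> t0 HV.
apply: (@fatou_ae _ _ _ P (fun r w => (mean_at Y (r.+1%:R * t) w - mean_at Y t w) ^+ 2) _
  (fun=> _)).
- move=> r; apply: measurable_funX; apply: measurable_funB.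
    by apply: (@measurable_torus_mean _ _ _ _ _ (fun i w => Y i (r.+1%:R * t) w)) => j.
  by apply: (@measurable_torus_mean _ _ _ _ _ (fun i w => Y i t w)) => j.
- by move=> r w; exact: sqr_ge0.
- by move=> w; exact: sqr_ge0.
- apply: filterS (ae_mean_cvg t0 HV) => w cw.
  have cl : mean_at Y (r.+1%:R * t) w @[r --> \oo] --> mean_limit Y w.
    apply: (@cvg_comp _ _ _ (fun r : nat => r.+1%:R * t) (fun s => mean_at Y s w) _ +oo); last exact: cw.
    apply/cvgryPge => A; exists (Num.truncn (A / t)) => // r /= hr.
    rewrite -ler_pdivrMr //; apply/ltW/(lt_le_trans (truncnS_gt _)).
    by rewrite ler_nat ltnS.
  have cd : mean_at Y (r.+1%:R * t) w - mean_at Y t w @[r --> \oo] -->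
      mean_limit Y w - mean_at Y t w by apply: cvgB => //; exact: cvg_cst.
  have -> : (mean_at Y t w - mean_limit Y w) ^+ 2 =
      (mean_limit Y w - mean_at Y t w) * (mean_limit Y w - mean_at Y t w) by ring.
  by apply: cvgM; exact: cd.
- by move=> r; exact: (mean_increment_bound proc d1 n3 Ify r t0).
- exact: cvg_cst.
Qed.

End limit.

Theorem theorem2p8 (R : realType) (d : nat) (a1 a2 a3 : R) :
  (1 <= d)%N -> admissible d a1 a2 a3 ->
  exists (n0 : nat) (t0 : R), [/\ (3 <= n0)%N, 0 < t0 &
  forall (n : nat) (t : R), odd n -> (n0 <= n)%N -> t0 <= t ->
  forall (dsp : measure_display) (Omega : measurableType dsp)
    (P : probability Omega R) (N : torus d n -> R -> {RV P >-> nat})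
    (Y : torus d n -> R -> {RV P >-> R}),
  smoothing_process N Y ->
  ('E_P[fun w => ((mean_at Y t w - mean_limit Y w) ^+ 2)%R] <=
   (a2 / Num.min (t `^ (d%:R / 2 + 1)) (n ^ (d + 2))%:R)%:E *
   'E_P[fun w => (((n ^ d)%:R^-1 *
          \sum_i `|Y i 0 w - median (fun j => Y j 0 w)|) ^+ 2)%R] *
   (expR (- (2 * gap R n / d%:R - a3 / (n ^ (d + 4))%:R) * t))%:E)%E].
Proof.
move=> d1 [a10 a20 a30 [n1 [t1 [n13 t10 adm]]]].
have [n2 hn2] := rate_eventually_gt0 a3 d1.
exists (maxn n1 n2), t1; split => //; first by rewrite leq_max n13.
move=> n t nodd; rewrite geq_max => /andP[n1n n2n] t1t dsp Om P N Y proc.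
have n3 : (3 <= n)%N by exact: leq_trans n1n.
have t0 : 0 < t by exact: lt_le_trans t1t.
have rate0 := hn2 n n2n (leq_trans (isT : (0 < 3)%N) n3).
set lam := _ - _ in rate0; rewrite -[2 * gap R n / d%:R - _]/lam.
set mn := Num.min _ _.
have nk0 k : 0 < (n ^ k)%:R :> R by rewrite ltr0n expn_gt0 (leq_trans _ n3).
have mn0 : 0 < mn by rewrite lt_min powR_gt0 //= nk0.
rewrite !expectation.unlock.
set I := (X in (_ * X * _)%E).
have I0 : (0 <= I)%E by apply: integral_ge0 => w _; rewrite lee_fin sqr_ge0.
(* With an infinite second moment the right-hand side is infinite. *)
have [Ify|] := ltP I +oo%E; last first.
  rewrite leye_eq => /eqP ->; rewrite gt0_muley ?lte_fin ?divr_gt0 //.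
  by rewrite gt0_mulye ?lte_fin ?expR_gt0 // leey.
pose A := delta_process N d1 n3.
have bounds s : t <= s -> _ := fun ts => adm n s nodd n1n (le_trans t1t ts) _ _ P N A
  (delta_process_smoothing proc d1 n3) (delta_process0 N d1 n3).
have [_ EE _ _] := bounds t (lexx t).
have EV s : t <= s -> fine (\int[P]_w (empirical_variance (fun i => A i s w))%:E)%E <=
    a2 * ((n ^ d)%:R^-1 / Num.min (t `^ (d%:R / 2)) (n ^ d)%:R) * (lam * s)^-1.
  move=> ts; have [_ _ _] := bounds s ts; rewrite expectation.unlock.
  have s0 : 0 < s by exact: lt_le_trans ts.
  have [_ fin] := expect_cvg proc d1 n3 (@empirical_variance_ge0 R d n) (empirical_variance_le1 n3) measurable_empirical_variance s0.
  rewrite -(fineK fin) lee_fin => /le_trans; apply.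
  have m0 (x : R) : 0 < x -> 0 < Num.min (x `^ (d%:R / 2)) (n ^ d)%:R.
    by move=> x0; rewrite lt_min powR_gt0 //= nk0.
  apply: ler_pM; rewrite ?expR_ge0 //.
  - by rewrite mulr_ge0 ?(ltW a20) // divr_ge0 ?invr_ge0 // ltW // m0.
  - rewrite ler_pM2l // ler_pM2l ?invr_gt0 // lef_pV2 ?posrE ?m0 //.
    rewrite le_min !ge_min lexx orbT andbT ge0_ler_powR ?nnegrE ?divr_ge0 // ltW //.
  - rewrite mulNr expRN lef_pV2 ?posrE ?expR_gt0 ?mulr_gt0 //.
    by apply: le_trans (expR_ge1Dx _); rewrite lerDr.
have HV : fine (\int[P]_w (empirical_variance (fun i => A i (r.+1%:R * t) w))%:E)%E
    @[r --> \oo] --> (0 : R).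
  pose C := a2 * ((n ^ d)%:R^-1 / Num.min (t `^ (d%:R / 2)) (n ^ d)%:R) * (lam * t)^-1.
  apply: (@squeeze_cvgr _ _ _ _ (cst 0) (fun r => C * harmonic r)).
  - apply: nearW => r; apply/andP; split.
      by apply: fine_ge0; apply: integral_ge0 => w _; rewrite lee_fin empirical_variance_ge0.
    apply: le_trans (EV _ _) _; first by rewrite ler_peMl ?ler1n // ltW.
    have -> : (lam * (r.+1%:R * t))^-1 = (lam * t)^-1 * harmonic r.
      by rewrite mulrCA invfM mulrC.
    by rewrite /C mulrA.
  - exact: cvg_cst.
  - by rewrite -[X in _ --> X](mulr0 C); apply: cvgM; [exact: cvg_cst|exact: cvg_harmonic].
apply: le_trans (mean_limit_bound proc Ify t0 HV) _.
have [_ fin] := expect_cvg proc d1 n3 (@energy_ge0 R d n) (@energy_le R d n) measurable_energy t0.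
rewrite muleAC -EFinM; apply: lee_wpmul2r => //.
move: EE; rewrite expectation.unlock -(fineK fin) !lee_fin => EE.
apply: le_trans (ler_wpM2l _ EE) _ => //; rewrite -/lam -/mn le_eqVlt.
by apply/orP; left; apply/eqP; field; rewrite !gt_eqF.
Qed.
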